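(* Let $m\ge1$ be a natural number, $n=2m+4$, $F=\mathbb{Z}^{2m+1}$, $G=\mathbb{Z}^3$, $\mathcal{A}=\operatorname{Sym}_{\mathbb{Z}}(\bigwedge^2F\oplus F\otimes G)\cong\mathbb{Z}[c_{ij},u_{ki}]$, and let $\mathcal{I}_n\subset\mathcal{A}$ be the ideal $$\mathcal{I}_n=(C^{m-1}\wedge u_1\wedge u_2\wedge u_3,\ C^m\wedge u_1,\ C^m\wedge u_2,\ C^m\wedge u_3)$$ (see context). The minimal graded free resolution of the cyclic $\mathcal{A}$-module $\mathcal{A}/\mathcal{I}_n$ is $$\begin{aligned}\mathcal{F}_\bullet:\ 0&\longrightarrow F\otimes(\textstyle\bigwedge^{2m+1}F)^{\otimes2}\otimes\bigwedge^3G\otimes\mathcal{A}(-2m,-3)\\ &\xrightarrow{\partial_3}(\textstyle\bigwedge^{2m+1}F)^{\otimes2}\otimes\bigwedge^2G\otimes\mathcal{A}(-2m,-2)\ \oplus\ \bigwedge^{2m+1}F\otimes\bigwedge^{2m}F\otimes\bigwedge^3G\otimes\mathcal{A}(-2m+1,-3)\\ &\xrightarrow{\partial_2}\textstyle\bigwedge^{2m+1}F\otimes\bigwedge^3G\otimes\mathcal{A}(-m+1,-3)\ \oplus\ \bigwedge^{2m+1}F\otimes G\otimes\mathcal{A}(-m,-1)\xrightarrow{\partial_1}\mathcal{A},\end{aligned}$$ with differentials $\partial_3,\partial_2,\partial_1$ as described in the context. For every field $k$ the resolution $\mathcal{F}_\bullet\otimes_{\mathbb{Z}}k$ is minimal over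 $$\mathcal{A}_k=\operatorname{Sym}_k(\textstyle\bigwedge^2\overline{F}\oplus\overline{F}\otimes\overline{G})\cong k[c_{ij},u_{ki}],\qquad \overline F=F\otimes_{\mathbb{Z}}k,\ \overline G=G\otimes_{\mathbb{Z}}k.$$ The ideal $\mathcal{I}_n\otimes_{\mathbb{Z}}k$ is thus perfect of grade three.
   Context: Here $\{g_1,\dots,g_{2m+1}\}$ is a basis of $F$, $A=(c_{ij})$ is the generic $(2m+1)\times(2m+1)$ skew symmetric matrix, $B=(u_{ki})$ the generic $3\times(2m+1)$ matrix, $C=\sum_{i<j}c_{ij}g_i\wedge g_j$, $u_k=\sum_{i=1}^{2m+1}u_{ki}g_i$, and $$C^j=\sum_{1\le i_1<\cdots<i_{2j}\le2m+1}\operatorname{Pf}_{i_1\ldots i_{2j}}(A)\,g_{i_1}\wedge\cdots\wedge g_{i_{2j}}\in\textstyle\bigwedge^{2j}F\otimes\mathcal{A},\qquad C^0=1,$$ with $\operatorname{Pf}_{i_1\ldots i_{2j}}(A)$ the Pfaffian of the submatrix on rows and columns $i_1,\dots,i_{2j}$. Elements of $\bigwedge^{2m+1}F\otimes\mathcal{A}$ are identified with elements of $\mathcal{A}$ via $g_1\wedge\cdots\wedge g_{2m+1}$. The bigrading is $|c_{ij}|=(1,0)$, $|u_{ki}|=(0,1)$, and $\mathcal{A}(-a,-b)$ is the free module with generator in bidegree $(a,b)$. Differentials: let $U$ be the $n\times n$ skew symmetric block matrix $\left(\begin{array}{c|c}O&B\\ \hline -B^T&A\end{array}\right)$ with $O$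 the $3\times3$ zero block, and let $\operatorname{pf}(\overline{i_1\ldots i_k})$ be the Pfaffian of the matrix obtained from $U$ by deleting rows and columns $i_1,\dots,i_k$. In suitable bases of the free modules, $$\partial_3=\left(\begin{array}{c}B\\ \hline A\end{array}\right),\qquad \partial_1=\begin{pmatrix}\operatorname{Pf}(U)&\operatorname{pf}(\overline{12})&\operatorname{pf}(\overline{13})&\operatorname{pf}(\overline{23})\end{pmatrix},$$ $$\partial_2=\begin{pmatrix}0&0&0&-\operatorname{pf}(\overline{1234})&\operatorname{pf}(\overline{1235})&\cdots&-\operatorname{pf}(\overline{123n})\\ \operatorname{pf}(\overline{13})&-\operatorname{pf}(\overline{23})&0&\operatorname{pf}(\overline{34})&-\operatorname{pf}(\overline{35})&\cdots&\operatorname{pf}(\overline{3n})\\-\operatorname{pf}(\overline{12})&0&\operatorname{pf}(\overline{23})&-\operatorname{pf}(\overline{24})&\operatorname{pf}(\overline{25})&\cdots&-\operatorname{pf}(\overline{2n})\\0&\operatorname{pf}(\overline{12})&-\operatorname{pf}(\overline{13})&\operatorname{pf}(\overline{14})&-\operatorname{pf}(\overline{15})&\cdots&\operatorname{pf}(\overline{1n})\end{pmatrix},$$ where the first basis element of the rank-$4$ module spans the summand with $\mathcal{A}(-m+1,-3)$ and the last three the summand with $G$; and the first three basis elements of the rank-$n$ module span the summand with $\bigwedge^2G$, the last $2m+1$ the summand with $\bigwedge^{2m}F$. *)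

(* Defs.v *)
From HB Require Import structures.
From mathcomp Require Import all_boot all_order all_algebra all_fingroup.
From mathcomp Require Import generic_quotient ring_quotient.
From mathcomp Require Import boolp.
From mathcomp Require Import mpoly.

Set Implicit Arguments.
Unset Strict Implicit.
Unset Printing Implicit Defensive.

Import GRing.Theory.
Local Open Scope ring_scope.

Section Ideals.
Variable R : comNzRingType.
Implicit Types (s : seq R) (x y a : R).

Definition in_ideal s x : Prop :=
  exists a : 'I_(size s) -> R, x = \sum_(i < size s) a i * s`_i.

Definition ideal_pred s : {pred R} := [pred x | `[< in_ideal s x >]].

Lemma ideal_predP s x : reflect (in_ideal s x) (x \in ideal_pred s).
Proof. exact: asboolP. Qed.

Lemma ideal_pred_zmod s : zmod_closed (ideal_pred s).
Proof.
split.
  by apply/ideal_predP; exists (fun=> 0); rewrite big1 // => i _; rewrite mul0r.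
move=> _ _ /ideal_predP[a ->] /ideal_predP[b ->]; apply/ideal_predP.
exists (fun i => a i - b i); rewrite -sumrB; apply: eq_bigr => i _.
by rewrite mulrBl.
Qed.

HB.instance Definition _ s :=
  GRing.isZmodClosed.Build R (ideal_pred s) (ideal_pred_zmod s).

Lemma ideal_predM s a x : x \in ideal_pred s -> a * x \in ideal_pred s.
Proof.
move=> /ideal_predP[b ->]; apply/ideal_predP; exists (fun i => a * b i).
by rewrite mulr_sumr; apply: eq_bigr => i _; rewrite mulrA.
Qed.

(* The R-module R / (s).  The library's [{ideal_quot _}] requires a proper
   ideal; here (s) is arbitrary. *)
Definition cyclic_module s : Type := Quotient.quot (ideal_pred s).

HB.instance Definition _ s :=
  ZmodQuotient.copy (cyclic_module s) (Quotient.quot (ideal_pred s)).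

Definition cyclic_pi s x : cyclic_module s := (\pi_(cyclic_module s) x)%qT.

Lemma cyclic_piP s x y :
  reflect (cyclic_pi s x = cyclic_pi s y) (x - y \in ideal_pred s).
Proof. by rewrite Quotient.idealrBE; apply: eqP. Qed.

Lemma cyclic_pi_surj s (z : cyclic_module s) : exists x, cyclic_pi s x = z.
Proof. by exists (repr z); rewrite /cyclic_pi reprK. Qed.

Lemma cyclic_piB s : zmod_morphism (cyclic_pi s).
Proof. by move=> x y; rewrite /cyclic_pi raddfB. Qed.

HB.instance Definition _ s :=
  GRing.isZmodMorphism.Build R (cyclic_module s) (cyclic_pi s) (@cyclic_piB s).

Definition cyclic_scale s a (z : cyclic_module s) : cyclic_module s :=
  cyclic_pi s (a * repr z).

Lemma cyclic_scale_pi s a x : cyclic_scale a (cyclic_pi s x) = cyclic_pi s (a * x).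
Proof.
apply/cyclic_piP; rewrite -mulrBr; apply: ideal_predM; apply/cyclic_piP.
by rewrite /cyclic_pi reprK.
Qed.

Lemma cyclic_scaleA s a b (z : cyclic_module s) :
  cyclic_scale a (cyclic_scale b z) = cyclic_scale (a * b) z.
Proof. by have [x <-] := cyclic_pi_surj z; rewrite !cyclic_scale_pi mulrA. Qed.

Lemma cyclic_scale1 s : left_id 1 (@cyclic_scale s).
Proof. by move=> z; have [x <-] := cyclic_pi_surj z; rewrite cyclic_scale_pi mul1r. Qed.

Lemma cyclic_scaleDr s : right_distributive (@cyclic_scale s) +%R.
Proof.
move=> a z w; have [x <-] := cyclic_pi_surj z; have [y <-] := cyclic_pi_surj w.
by rewrite -raddfD !cyclic_scale_pi -raddfD mulrDr.
Qed.

Lemma cyclic_scaleDl s (z : cyclic_module s) :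
  {morph (@cyclic_scale s)^~ z : a b / a + b}.
Proof.
move=> a b; have [x <-] := cyclic_pi_surj z.
by rewrite !cyclic_scale_pi -raddfD mulrDl.
Qed.

HB.instance Definition _ s :=
  GRing.Zmodule_isLmodule.Build R (cyclic_module s)
    (@cyclic_scaleA s) (@cyclic_scale1 s) (@cyclic_scaleDr s) (@cyclic_scaleDl s).

Definition regular_sequence (xs : seq R) : Prop :=
  (forall i, (i < size xs)%N ->
     forall y, in_ideal (take i xs) (xs`_i * y) -> in_ideal (take i xs) y)
  /\ ~ in_ideal xs 1.

Definition ideal_has_grade s (g : nat) : Prop :=
  (exists xs, [/\ regular_sequence xs, {in xs, forall x, in_ideal s x}
                & size xs = g])
  /\ (forall xs, regular_sequence xs -> {in xs, forall x, in_ideal s x} ->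
        (size xs <= g)%N).

End Ideals.

Section Perfect.
Variable R : comNzRingType.

Definition surjective_map (S T : Type) (f : S -> T) : Prop :=
  forall z, exists w, f w = z.

Definition projective (P : lmodType R) : Prop :=
  forall (M N : lmodType R) (g : {linear M -> N}) (f : {linear P -> N}),
    surjective_map g -> exists h : {linear P -> M}, forall x, g (h x) = f x.

Definition proj_dim_le (M : lmodType R) (d : nat) : Prop :=
  exists (P : nat -> lmodType R) (D : forall i, {linear P i.+1 -> P i})
         (e : {linear P 0%N -> M}),
  [/\ forall i, projective (P i),
      forall i, (d < i)%N -> forall x : P i, x = 0,
      surjective_map e,
      forall x, e x = 0 <-> exists y, x = D 0%N y
    & forall i x, D i x = 0 <-> exists y, x = D i.+1 y].

Definition has_proj_dim (M : lmodType R) (d : nat) : Prop :=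
  proj_dim_le M d /\ forall d', proj_dim_le M d' -> (d <= d')%N.

Definition perfect_of_grade (s : seq R) (g : nat) : Prop :=
  ideal_has_grade s g /\ has_proj_dim (cyclic_module s) g.

End Perfect.

Section Pfaffian.
Variable R : comNzRingType.

(* Permutations s of {0, .., n-1} with s 0 < s 1, s 2 < s 3, .. and
   s 0 < s 2 < s 4 < ..; for n even they correspond to the perfect matchings
   {s 0, s 1}, {s 2, s 3}, .. of {0, .., n-1}. *)
Definition matching_perm n (s : 'S_n) : bool :=
  [forall i : 'I_n, forall j : 'I_n,
     ~~ odd i ==> ((j == i.+1 :> nat) || (j == i.+2 :> nat)) ==> (s i < s j)%N].

Definition Pf n (M : 'M[R]_n) : R :=
  if odd n then 0 else
  \sum_(s : 'S_n | matching_perm s)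
     (-1) ^+ s * \prod_(i < n | ~~ odd i)
                   \prod_(j < n | j == i.+1 :> nat) M (s i) (s j).

(* [enum_val] lists the elements of S in increasing order. *)
Definition PfS n (M : 'M[R]_n) (S : {set 'I_n}) : R :=
  Pf (mxsub (@enum_val _ (mem S)) (@enum_val _ (mem S)) M).

(* pf(\overline{i_1 .. i_k}), with row and column numbers starting at 1. *)
Definition pfbar n (M : 'M[R]_n) (l : seq nat) : R :=
  PfS M [set i : 'I_n | i.+1 \notin l].

End Pfaffian.

(* The exterior algebra of the free module on g_0, .., g_(N-1): a (S) is the
   coefficient of g_S, the wedge product of the g_i, i in S, in increasing
   order of i. *)
Section Exterior.
Variables (R : comNzRingType) (N : nat).

Definition ext := {ffun {set 'I_N} -> R}.

(* g_S /\ g_T = (-1) ^ (inversions S T) g_(S :|: T) for disjoint S and T. *)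
Definition inversions (S T : {set 'I_N}) : nat :=
  #|[set p : 'I_N * 'I_N | [&& p.1 \in S, p.2 \in T & (p.2 < p.1)%N]]|.

Definition wedge (a b : ext) : ext :=
  [ffun S : {set 'I_N} => \sum_(T : {set 'I_N} | T \subset S)
     (-1) ^+ inversions T (S :\: T) * a T * b (S :\: T)].

Definition ext_vector (u : 'rV[R]_N) : ext :=
  [ffun S : {set 'I_N} => \sum_i u 0 i * (S == [set i])%:R].

Definition pf_form (M : 'M[R]_N) (j : nat) : ext :=
  [ffun S : {set 'I_N} => if #|S| == (2 * j)%N then PfS M S else 0].

Definition top_coef (a : ext) : R := a [set: 'I_N].

End Exterior.

Section GradedResolutions.
Variables (R : comNzRingType) (n : nat) (bideg : 'X_{1..n} -> nat * nat).
Local Notation A := {mpoly R[n]}.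

(* A bigraded free module is given as its list of summands: (r, (a, b)) stands
   for Z^r (x) A(-a,-b). *)
Definition graded_free := seq (nat * (nat * nat)).

Definition basis_bidegrees (F : graded_free) : seq (nat * nat) :=
  flatten [seq nseq t.1 t.2 | t <- F].

(* d is a map F -> G, acting on columns, that is homogeneous of bidegree (0,0). *)
Definition bigraded_map (F G : graded_free) p q (d : 'M[A]_(p, q)) : Prop :=
  [/\ size (basis_bidegrees F) = q, size (basis_bidegrees G) = p
    & forall i j mu, mu \in msupp (d i j) ->
        let a := nth (0, 0)%N (basis_bidegrees G) i in
        let b := nth (0, 0)%N (basis_bidegrees F) j in
        b = ((bideg mu).1 + a.1, (bideg mu).2 + a.2)%N].

(* The image lies in the irrelevant ideal (the polynomials without constant
   term) times the target. *)
Definition minimal_map p q (d : 'M[A]_(p, q)) : Prop :=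
  forall (v : 'cV[A]_q) i, ((d *m v) i 0)@_0%MM = 0.

(* 0 -> F3 -> F2 -> F1 -> A is a minimal bigraded free resolution of A / (s). *)
Definition minimal_graded_free_resolution (s : seq A) (F3 F2 F1 : graded_free)
    r3 r2 r1 (d3 : 'M[A]_(r2, r3)) (d2 : 'M[A]_(r1, r2)) (d1 : 'M[A]_(1, r1)) : Prop :=
  [/\ [/\ bigraded_map F3 F2 d3, bigraded_map F2 F1 d2
        & bigraded_map F1 [:: (1, (0, 0))]%N d1],
      [/\ forall v : 'cV_r3, d3 *m v = 0 -> v = 0,
          forall v : 'cV_r2, d2 *m v = 0 <-> exists w, v = d3 *m w,
          forall v : 'cV_r1, d1 *m v = 0 <-> exists w, v = d2 *m w
        & forall x : A, cyclic_pi s x = 0 <-> exists w : 'cV_r1, x%:M = d1 *m w]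
    & [/\ minimal_map d3, minimal_map d2 & minimal_map d1]].

End GradedResolutions.

Section Generic.
Variable m : nat.

Local Notation N := (2 * m).+1.

(* The variables c_ij for i < j, and u_ki. *)
Definition cvar := {p : 'I_N * 'I_N | (p.1 < p.2)%N}.
Definition uvar := ('I_3 * 'I_N)%type.
Definition gvar := (cvar + uvar)%type.

Local Notation genring R := {mpoly R[#|{: gvar}|]}.

Definition gX (v : gvar) : genring int := 'X_(enum_rank v).

Definition cgen (i j : 'I_N) : genring int :=
  if insub (i, j) is Some p then gX (inl p) else 0.

Definition matA : 'M[genring int]_N := \matrix_(i, j) (cgen i j - cgen j i).

Definition matB : 'M[genring int]_(3, N) := \matrix_(k, i) gX (inr (k, i)).

Definition matU : 'M[genring int]_(3 + N) := block_mx 0 matB (- matB^T) matA.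

Definition gbideg (mu : 'X_{1..#|{: gvar}|}) : nat * nat :=
  (\sum_(p : cvar) mu (enum_rank (inl p : gvar)),
   \sum_(p : uvar) mu (enum_rank (inr p : gvar)))%N.

Definition Cform (j : nat) : ext (genring int) N := pf_form matA j.

(* u_(k+1) *)
Definition uform (k : 'I_3) : ext (genring int) N := ext_vector (row k matB).

Definition In_gens : seq (genring int) :=
  let u1 := uform (inord 0) in let u2 := uform (inord 1) in
  let u3 := uform (inord 2) in
  [:: top_coef (wedge (wedge (wedge (Cform m.-1) u1) u2) u3);
      top_coef (wedge (Cform m) u1);
      top_coef (wedge (Cform m) u2);
      top_coef (wedge (Cform m) u3)].

Local Notation pf := (pfbar matU).

Definition diff1 : 'M[genring int]_(1, 4) :=
  \row_(j < 4) nth 0 [:: Pf matU; pf [:: 1; 2]; pf [:: 1; 3]; pf [:: 2; 3]]%N j.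

Definition diff2_left : 'M[genring int]_(4, 3) :=
  \matrix_(i < 4, j < 3) nth 0 (nth [::]
    [:: [:: 0;                 0;                 0];
        [:: pf [:: 1; 3]%N;    - pf [:: 2; 3]%N;  0];
        [:: - pf [:: 1; 2]%N;  0;                 pf [:: 2; 3]%N];
        [:: 0;                 pf [:: 1; 2]%N;    - pf [:: 1; 3]%N]] i) j.

(* The column of index j has l = j + 4 in the overlined Pfaffians. *)
Definition diff2_right : 'M[genring int]_(4, N) :=
  \matrix_(i < 4, j < N) let l := (j + 4)%N in nth 0
    [:: - (-1) ^+ l * pf [:: 1; 2; 3; l]%N;
        (-1) ^+ l * pf [:: 3; l]%N;
        - (-1) ^+ l * pf [:: 2; l]%N;
        (-1) ^+ l * pf [:: 1; l]%N] i.

Definition diff2 : 'M[genring int]_(4, 3 + N) := row_mx diff2_left diff2_right.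

Definition diff3 : 'M[genring int]_(3 + N, N) := col_mx matB matA.

(* Ranks of F and G; the p-th exterior power of Z^r has rank 'C(r, p), and the
   rank of a tensor product is the product of the ranks. *)
Local Notation rkF := N.
Local Notation rkG := 3%N.

Definition term3 : graded_free :=
  [:: (rkF * 'C(rkF, N) ^ 2 * 'C(rkG, 3), (2 * m, 3))]%N.

Definition term2 : graded_free :=
  [:: ('C(rkF, N) ^ 2 * 'C(rkG, 2), (2 * m, 2));
      ('C(rkF, N) * 'C(rkF, 2 * m) * 'C(rkG, 3), ((2 * m).-1, 3))]%N.

Definition term1 : graded_free :=
  [:: ('C(rkF, N) * 'C(rkG, 3), (m.-1, 3));
      ('C(rkF, N) * rkG, (m, 1))]%N.

(* The base change genring int -> genring k, x |-> x (x) 1. *)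
Definition base_change (k : fieldType) (p : genring int) : genring k :=
  map_mpoly (intr : int -> k) p.

End Generic.

(* Main.v *)
From HB Require Import structures.
Require Import Defs.
From mathcomp Require Import all_boot all_order all_algebra all_fingroup.
From mathcomp Require Import ring zify.
From mathcomp Require Import boolp.
From mathcomp Require Import mpoly ssrcomplements.

Set Implicit Arguments.
Unset Strict Implicit.
Unset Printing Implicit Defensive.

Import GRing.Theory.
Local Open Scope ring_scope.

(** Write U for the skew matrix with blocks 0, B and A, and p_k, for an upper
    index k = 1, 2, 3, for the Pfaffian of what is left of U when the two other
    upper indices are deleted.  These are three of the four generators of the
    ideal I, and they control the whole complex, for two reasons.

    First, multiplication by p_k on the complex is homotopic to zero
    ([top_pf_null_homotopic]).  The matrix A bordered by the row k of B has even
    size and Pfaffian p_k, and its Pfaffian adjoint, which inverts it up to the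
    factor p_k, splits the complex up to that factor.  All identities that this
    requires come from Pfaffians indexed by lists: the expansion along the first
    row ([pfl_cons]) of a list in which an index is repeated vanishes
    ([pfl_mem]).

    Secondly, p_1, p_2, p_3 form a regular sequence, over any ring of
    coefficients ([top_pf_regular]).  For suitable weights of the variables the
    initial monomial of p_k comes from the matching that pairs the outermost
    indices, then the next ones, and so on, when k is placed before, in the
    middle of, or after the lower indices.  The sum of the positions of the two
    partners is constant along each of these three matchings, with three
    different values, so that the three monomials are coprime.  Coprime initial
    monomials suffice ([weakly_regular_initial]): replacing them by the p_k in
    every monomial is a unitriangular linear map, hence a bijection, and it
    turns multiplication by the monomials into multiplication by the p_k.

    A complex of length three on which the members of a regular sequence of
    length three are null-homotopic is exact ([acyclic]); this gives the
    resolution ([res_exact]).  That it is a complex at the last step, a Plucker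
    relation, follows from the homotopies as well ([res12]).  It is minimal
    because no two basis elements of neighbouring terms have the same bidegree
    ([bigraded_minimal]).

    For perfection, every element of I is null-homotopic on the resolution, so
    the same acyclicity lemma applies to the dual complex: a regular sequence of
    length four in I would make its last map surjective
    ([regular_size_le3]), against minimality.  Likewise a projective resolution
    of length two would split the last map ([proj_dim_ge3]).  The
    coefficients range over any commutative ring, so that the integers and the
    fields are treated together. *)

(** * Alternating sums over a list *)

Section Contraction.
Variables (J : eqType) (S : comNzRingType).
Implicit Types (s t : seq J) (G : J -> seq J -> S).

(** The sum of (-1)^i G (s_i) (s without s_i) over the positions i of s: the
    shape of a Laplace expansion.  The recursive form needs no arithmetic on
    positions. *)
Fixpoint contract G s : S :=
  if s is x :: t then G x t - contract (fun y r => G y (x :: r)) t else 0.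

Lemma contract_cons G x s :
  contract G (x :: s) = G x s - contract (fun y t => G y (x :: t)) s.
Proof. by []. Qed.

Lemma contract_ind (Q : S -> Prop) G s :
  Q 0 -> (forall x y, Q x -> Q y -> Q (x - y)) ->
  (forall s1 y s2, s = s1 ++ y :: s2 -> Q (G y (s1 ++ s2))) ->
  Q (contract G s).
Proof.
move=> Q0 QB; elim: s G => [|x s IHs] G HG //=.
apply: QB; first exact: (HG [::]).
by apply: IHs => s1 y s2 def_s; apply: (HG (x :: s1) y s2); rewrite def_s.
Qed.

Lemma eq_contract G G' s :
  (forall s1 y s2, s = s1 ++ y :: s2 -> G y (s1 ++ s2) = G' y (s1 ++ s2)) ->
  contract G s = contract G' s.
Proof.
elim: s G G' => [|x s IHs] G G' eqG //=; congr (_ - _); first exact: (eqG [::]).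
by apply: IHs => s1 y s2 def_s; apply: (eqG (x :: s1) y s2); rewrite def_s.
Qed.

Lemma contract0 G s :
  (forall s1 y s2, s = s1 ++ y :: s2 -> G y (s1 ++ s2) = 0) -> contract G s = 0.
Proof. by move=> G0; apply: (@contract_ind (fun z => z = 0)) => // x y -> ->; rewrite subrr. Qed.

Lemma contractB G G' s :
  contract (fun y t => G y t - G' y t) s = contract G s - contract G' s.
Proof.
elim: s G G' => [|x s IHs] G G' /=; first by rewrite subrr.
by rewrite IHs opprB addrACA opprB [RHS]addrACA [- _ + _]addrC.
Qed.

Lemma contractM c G s : contract (fun y t => c * G y t) s = c * contract G s.
Proof.
elim: s G => [|x s IHs] G /=; first by rewrite mulr0.
by rewrite IHs mulrBr.
Qed.

Lemma contract_cat G s1 s2 :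
  contract G (s1 ++ s2) = contract (fun y t => G y (t ++ s2)) s1
    + (-1) ^+ size s1 * contract (fun y t => G y (s1 ++ t)) s2.
Proof.
elim: s1 G => [|x s1 IHs] G /=; first by rewrite expr0 mul1r add0r.
by rewrite IHs exprS mulN1r mulNr opprD addrA.
Qed.

Lemma contractN G s : contract (fun y t => - G y t) s = - contract G s.
Proof. by rewrite -mulN1r -contractM; apply: eq_contract => *; rewrite mulN1r. Qed.

(** Contracting twice is alternating: the two ways of removing a given pair of
    positions carry opposite signs. *)
Lemma contract2C (H : J -> J -> seq J -> S) s :
  contract (fun y => contract (H y)) s =
  - contract (fun y => contract (H^~ y)) s.
Proof.
elim: s H => [|x s IHs] H /=; first by rewrite oppr0.
have E (K : J -> J -> seq J -> S) :
  contract (fun y r => K y x r - contract (fun z t => K y z (x :: t)) r) s =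
  contract (K^~ x) s - contract (fun y => contract (fun z t => K y z (x :: t))) s.
  exact: contractB.
rewrite (E H) (E (fun z y => H y z)) (IHs (fun y z t => H y z (x :: t))).
ring.
Qed.

Lemma contract2_sym (H : J -> J -> seq J -> S) s :
  (forall y z t, H y z t = H z y t) -> contract (fun y => contract (H y)) s = 0.
Proof.
elim: s H => [|x s IHs] H symH //=.
have -> : contract (fun y r => H y x r - contract (fun z t => H y z (x :: t)) r) s =
  contract (H^~ x) s - contract (fun y => contract (fun z t => H y z (x :: t))) s.
  exact: contractB.
rewrite (IHs (fun y z t => H y z (x :: t))) ?subr0 //.
by apply/eqP; rewrite subr_eq0; apply/eqP/eq_contract.
Qed.

End Contraction.

(** * Pfaffians of lists of indices *)

Section ListPfaffian.
Variables (J : eqType) (S : comNzRingType) (M : J -> J -> S).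
Implicit Types s t : seq J.

(** The argument k bounds the length of the list and makes the recursion
    structural. *)
Fixpoint pfl_rec k s : S :=
  match k, s with
  | k'.+1, x :: t => contract (fun y r => M x y * pfl_rec k' r) t
  | _, x :: t => 0
  | _, [::] => 1
  end.

(** Pfaffians are indexed by lists rather than sets, so that indices can be
    permuted and repeated. *)
Definition pfl s := pfl_rec (size s) s.

Lemma pfl_nil : pfl [::] = 1. Proof. by []. Qed.

Lemma pfl_recE k s : (size s <= k)%N -> pfl_rec k s = pfl s.
Proof.
rewrite /pfl; have [p] := ubnP (size s).
elim: p s k => // p IHp [|x t] [|k] //= le_p le_k.
apply: eq_contract => s1 y s2 def_t.
have sz_t : size t = (size (s1 ++ s2)).+1 by rewrite def_t !size_cat /= addnS.
by congr (_ * _); rewrite !IHp //; lia.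
Qed.

Lemma pfl_cons x t : pfl (x :: t) = contract (fun y r => M x y * pfl r) t.
Proof.
rewrite {1}/pfl /=; apply: eq_contract => s1 y s2 def_t.
by congr (_ * _); rewrite pfl_recE // def_t !size_cat /= addnS.
Qed.

Lemma pfl_odd s : odd (size s) -> pfl s = 0.
Proof.
have [p] := ubnP (size s); elim: p s => // p IHp [|x t] //= le_p odd_t.
rewrite pfl_cons; apply: contract0 => s1 y s2 def_t.
have sz_t : size t = (size (s1 ++ s2)).+1 by rewrite def_t !size_cat /= addnS.
by rewrite IHp ?mulr0 //; [lia | move: odd_t; rewrite sz_t /= negbK].
Qed.

Section Alternating.
Hypotheses (M_skew : forall x y, M x y = - M y x) (M_diag : forall x, M x x = 0).

Lemma pfl_cons2 x y s : pfl (x :: y :: s) =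
  M x y * pfl s - contract (fun z => contract (fun w r => M x z * M y w * pfl r)) s.
Proof.
rewrite pfl_cons contract_cons; congr (_ - _); apply: eq_contract => s1 z s2 _.
rewrite pfl_cons -contractM; apply: eq_contract => *.
by rewrite mulrA.
Qed.

(** At the head of the list this is the alternation of a double expansion; a
    swap further inside is carried through the expansion along the head. *)
Lemma pfl_swap s1 x y s2 : pfl (s1 ++ x :: y :: s2) = - pfl (s1 ++ y :: x :: s2).
Proof.
have [p] := ubnP (size s1); elim: p s1 s2 => // p IHp [|c s1] s2 /= le_p.
  rewrite !pfl_cons2 M_skew mulNr opprB contract2C opprK addrC; congr (_ - _).
  by apply: eq_contract => *; apply: eq_contract => *; rewrite [M x _ * _]mulrC.
rewrite !pfl_cons !contract_cat opprD; congr (_ + _).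
  rewrite -contractN; apply: eq_contract => r1 z r2 def_s1.
  by rewrite IHp ?mulrN //; move: le_p; rewrite def_s1 !size_cat /=; lia.
rewrite -mulrN; congr (_ * _); rewrite !contract_cons.
have -> : contract (fun z t => M c z * pfl (s1 ++ x :: y :: t)) s2 =
          - contract (fun z t => M c z * pfl (s1 ++ y :: x :: t)) s2.
  rewrite -contractN; apply: eq_contract => *.
  by rewrite IHp ?mulrN.
ring.
Qed.

(** When 2 is a zero divisor this does not follow from [pfl_swap]. *)
Lemma pfl_dup s1 x s2 : pfl (s1 ++ x :: x :: s2) = 0.
Proof.
have [p] := ubnP (size s1); elim: p s1 s2 => // p IHp [|c s1] s2 /= le_p.
  rewrite pfl_cons2 M_diag mul0r sub0r contract2_sym ?oppr0 // => *.
  by rewrite [M x _ * _]mulrC.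
rewrite pfl_cons contract_cat /= subKr.
rewrite !contract0 ?mulr0 ?addr0 // => r1 z r2 def_s.
  by rewrite IHp ?mulr0.
by rewrite IHp ?mulr0 //; move: le_p; rewrite def_s !size_cat /=; lia.
Qed.

Lemma pfl_move s0 x s1 s2 :
  pfl (s0 ++ x :: s1 ++ s2) = (-1) ^+ size s1 * pfl (s0 ++ s1 ++ x :: s2).
Proof.
elim: s1 s0 => [|y s1 IHs] s0 /=; first by rewrite mul1r.
by rewrite pfl_swap -cat_rcons IHs cat_rcons exprS mulN1r mulNr.
Qed.

(** Expanded along x, this says that a row already in the list is orthogonal to
    the vector of signed sub-Pfaffians, which is what the relations below use. *)
Lemma pfl_mem x s : x \in s -> pfl (x :: s) = 0.
Proof.
by case/splitPr=> s1 s2; rewrite (pfl_move [::]) pfl_dup mulr0.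
Qed.

End Alternating.
End ListPfaffian.


(** * Expansions indexed by positions *)

Section Positions.
Variable S : comNzRingType.

Definition del (J : Type) i (s : seq J) := take i s ++ drop i.+1 s.

Lemma size_del (J : Type) i (s : seq J) : (i < size s)%N -> size (del i s) = (size s).-1.
Proof. by move=> lt_i; rewrite /del size_cat size_take size_drop lt_i; lia. Qed.

Lemma map_del (I J : Type) (f : I -> J) i (s : seq I) : map f (del i s) = del i (map f s).
Proof. by rewrite /del map_cat map_take map_drop. Qed.

Lemma del_del (J : Type) i j (s : seq J) : (i <= j)%N -> (j.+1 < size s)%N ->
  del j (del i s) = del i (del j.+1 s).
Proof.
elim: s i j => [|x s IHs] [|i] [|j] //= le_ij lt_j; rewrite /del /=.
1,2: by rewrite ?drop0.
by congr (_ :: _); apply: IHs.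
Qed.

Lemma contract_sum (J : eqType) (x0 : J) (G : J -> seq J -> S) s :
  contract G s = \sum_(i < size s) (-1) ^+ i * G (nth x0 s i) (del i s).
Proof.
elim: s G => [|x s IHs] G /=; first by rewrite big_ord0.
rewrite big_ord_recl /= mul1r /del /= drop0 IHs -sumrN; congr (_ + _).
by apply: eq_bigr => i _; rewrite exprS mulN1r mulNr.
Qed.

Lemma contract_enum (J : eqType) n (f : 'I_n -> J) (G : J -> seq J -> S) :
  contract G (map f (enum 'I_n)) =
  \sum_(i < n) (-1) ^+ i * G (f i) (del i (map f (enum 'I_n))).
Proof.
case: n f => [|n] f.
  by rewrite big_ord0; case: (enum _) (size_enum_ord 0).
have sz: size (map f (enum 'I_n.+1)) = n.+1 by rewrite size_map size_enum_ord.
rewrite (contract_sum (f ord0)) sz; apply: eq_bigr => i _.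
by rewrite (nth_map ord0) ?size_enum_ord // nth_ord_enum.
Qed.

Lemma del_enum n (i : 'I_n.+1) : del i (enum 'I_n.+1) = map (lift i) (enum 'I_n).
Proof.
apply: (@eq_from_nth _ ord0) => [|j].
  by rewrite size_map size_del size_enum_ord ?size_enum_ord.
rewrite size_del size_enum_ord // => lt_j; apply: val_inj.
rewrite (nth_map (Ordinal lt_j)) ?size_enum_ord // (nth_ord_enum _ (Ordinal lt_j)) /=.
rewrite /del nth_cat size_take size_enum_ord ltn_ord /bump.
have [lt_ji|le_ij] := ltnP j i; first by rewrite nth_take // nth_enum_ord //; lia.
by rewrite nth_drop nth_enum_ord; lia.
Qed.

Lemma pfl_map (I J : eqType) (f : I -> J) (M : J -> J -> S) s :
  pfl M (map f s) = pfl (fun x y => M (f x) (f y)) s.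
Proof.
have [p] := ubnP (size s); elim: p s => // p IHp [|x s] //= le_p.
rewrite !pfl_cons.
have contract_map (G : J -> seq J -> S) t :
    contract G (map f t) = contract (fun y r => G (f y) (map f r)) t.
  by elim: t G => //= y t IHt G; rewrite IHt.
rewrite contract_map; apply: eq_contract => s1 y s2 def_s.
by rewrite IHp //; move: le_p; rewrite def_s !size_cat /=; lia.
Qed.

Lemma eq_pfl (J : eqType) (M M' : J -> J -> S) s :
  (forall x y, M x y = M' x y) -> pfl M s = pfl M' s.
Proof.
move=> eqM; have [p] := ubnP (size s); elim: p s => // p IHp [|x s] //= le_p.
rewrite !pfl_cons; apply: eq_contract => s1 y s2 def_s.
by rewrite eqM IHp //; move: le_p; rewrite def_s !size_cat /=; lia.
Qed.

End Positions.

Lemma pfl_rmorph (J : eqType) (S S' : comNzRingType) (phi : {rmorphism S -> S'})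
    (M : J -> J -> S) s :
  phi (pfl M s) = pfl (fun x y => phi (M x y)) s.
Proof.
have contract_rmorph (G : J -> seq J -> S) t :
    phi (contract G t) = contract (fun y r => phi (G y r)) t.
  by elim: t G => [|y t IHt] G /=; rewrite ?rmorph0 // rmorphB IHt.
have [p] := ubnP (size s); elim: p s => // p IHp [|x s] /= le_p; first by rewrite rmorph1.
rewrite !pfl_cons contract_rmorph; apply: eq_contract => s1 y s2 def_s.
by rewrite rmorphM IHp //; move: le_p; rewrite def_s !size_cat /=; lia.
Qed.

(** * Matchings and the expansion along the first row *)

Section PfaffianExpansion.
Variable S : comNzRingType.

(** A matching permutation increases inside each pair and along the first
    elements of the pairs. *)
Lemma matching_perm0 n (s : 'S_n.+1) : matching_perm s -> s ord0 = ord0.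
Proof.
move=> /forallP ms.
have lt_s (i j : 'I_n.+1) : ~~ odd i -> (j == i.+1 :> nat) || (j == i.+2 :> nat) ->
    (s i < s j)%N.
  by move=> ev_i ij; move/forallP: (ms i) => /(_ j); rewrite ev_i ij.
suffices le0 (i : 'I_n.+1) : (s ord0 <= s i)%N.
  by apply/val_inj/eqP; rewrite /= -leqn0; have:= le0 (s^-1 ord0)%g; rewrite permKV.
have [p] := ubnP i; elim: p i => // p IHp i le_i.
have [i0|i_gt0] := posnP i; first by rewrite (_ : i = ord0) //; apply: val_inj.
have lt_n k : (k <= i)%N -> (k < n.+1)%N by move=> le_k; apply: leq_ltn_trans le_k _.
have [odd_i|ev_i] := boolP (odd i).
  have lt_p : (i.-1 < n.+1)%N by apply: lt_n; lia.
  apply: leq_trans (IHp (Ordinal lt_p) _) (ltnW (lt_s (Ordinal lt_p) i _ _)) => /=; lia.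
have lt_p : (i.-2 < n.+1)%N by apply: lt_n; lia.
apply: leq_trans (IHp (Ordinal lt_p) _) (ltnW (lt_s (Ordinal lt_p) i _ _)) => /=; lia.
Qed.

(** The matching permutation that pairs the smallest index with j and the
    others according to t. *)
Definition matching_lift n (j : 'I_n.+1) (t : 'S_n) : 'S_n.+2 :=
  lift_perm ord0 ord0 (lift_perm ord0 j t).

Lemma matching_lift_lift n (j : 'I_n.+1) (t : 'S_n) i :
  matching_lift j t (lift ord0 (lift ord0 i)) = lift ord0 (lift j (t i)).
Proof. by rewrite /matching_lift !lift_perm_lift. Qed.

Lemma matching_lift1 n (j : 'I_n.+1) (t : 'S_n) :
  matching_lift j t (lift ord0 ord0) = lift ord0 j.
Proof. by rewrite /matching_lift lift_perm_lift lift_perm_id. Qed.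

Lemma matching_lift0 n (j : 'I_n.+1) (t : 'S_n) : matching_lift j t ord0 = ord0.
Proof. by rewrite /matching_lift lift_perm_id. Qed.

Lemma matching_liftP n (j : 'I_n.+1) (t : 'S_n) :
  matching_perm (matching_lift j t) = matching_perm t.
Proof.
have lt_lift (a b : 'I_n) :
    (lift ord0 (lift j a) < lift ord0 (lift j b))%N = (a < b)%N.
  by rewrite !lift0 ltnS /= !ltnNge leq_bump2.
apply/idP/idP => /forallP mt; apply/forallP => i; apply/forallP => k.
  have /forallP/(_ (lift ord0 (lift ord0 k))) := mt (lift ord0 (lift ord0 i)).
  by rewrite !matching_lift_lift lt_lift !lift0 /= !eqSS negbK.
have [i'|] := unliftP ord0 i; last first.
  move=> ->; rewrite matching_lift0; have [k'|->] := unliftP ord0 k; last by [].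
  by move=> ->; rewrite /matching_lift lift_perm_lift lift0 /= implybT.
move=> ->; have [i''|->] := unliftP ord0 i'; last by rewrite lift0.
move=> ->; have [k'|->] := unliftP ord0 k; last by rewrite !lift0 /= implybT.
move=> ->; have [k''|->] := unliftP ord0 k'; last by rewrite !lift0 /= implybT.
move=> ->; rewrite !matching_lift_lift lt_lift !lift0 /= !eqSS negbK.
by have /forallP/(_ k'') := mt i''.
Qed.

Lemma matching_lift_inj n (j j' : 'I_n.+1) (t t' : 'S_n) :
  matching_lift j t = matching_lift j' t' -> (j, t) = (j', t').
Proof.
move=> eq_jt; have eq_j : j = j'.
  by apply: (@lift_inj _ ord0); rewrite -(matching_lift1 j t) eq_jt matching_lift1.
rewrite -eq_j in eq_jt *; congr (_, _); apply/permP => i.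
by apply: (@lift_inj _ j); apply: (@lift_inj _ ord0); 
rewrite -matching_lift_lift eq_jt matching_lift_lift.
Qed.

Lemma lift_perm0P n (s : 'S_n.+1) : exists t, s = lift_perm ord0 (s ord0) t.
Proof.
pose f i := odflt i (unlift (s ord0) (s (lift ord0 i))).
have fE i : lift (s ord0) (f i) = s (lift ord0 i).
  rewrite /f; case: unliftP => //= /perm_inj/eqP.
  by rewrite eq_sym (negPf (neq_lift _ _)).
have inj_f : injective f.
  by move=> a b eq_f; have := fE a; rewrite eq_f fE => /perm_inj/lift_inj.
exists (perm inj_f); apply/permP => i; have [j ->|->] := unliftP ord0 i.
  by rewrite lift_perm_lift permE fE.
by rewrite lift_perm_id.
Qed.

Lemma matching_liftE n (s : 'S_n.+2) :
  matching_perm s -> exists j, exists t, s = matching_lift j t.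
Proof.
move/matching_perm0 => s0; have [t] := lift_perm0P s; rewrite s0 => def_s.
have [t' def_t] := lift_perm0P t.
by exists (t ord0), t'; rewrite /matching_lift -def_t.
Qed.

Lemma matching_lift_odd n (j : 'I_n.+1) (t : 'S_n) :
  (-1) ^+ (matching_lift j t : bool) = (-1) ^+ j * (-1) ^+ (t : bool) :> S.
Proof.
by rewrite /matching_lift !odd_lift_perm /= signr_addb signr_odd.
Qed.

Definition pairs_prod n (M : 'M[S]_n) (s : 'S_n) : S :=
  \prod_(i < n | ~~ odd i) \prod_(j < n | j == i.+1 :> nat) M (s i) (s j).

Lemma matching_lift_prod n (M : 'M[S]_n.+2) (j : 'I_n.+1) (t : 'S_n) :
  pairs_prod M (matching_lift j t) =
  M ord0 (lift ord0 j) *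
    pairs_prod (\matrix_(a, b) M (lift ord0 (lift j a)) (lift ord0 (lift j b))) t.
Proof.
rewrite /pairs_prod big_mkcond big_ord_recl /= big_ord_recl /= mul1r; congr (_ * _).
  rewrite big_mkcond big_ord_recl /= mul1r big_ord_recl /=.
  by rewrite matching_lift0 matching_lift1 big1 ?mulr1 // => i _; rewrite !lift0.
rewrite [RHS]big_mkcond; apply: eq_bigr => i _.
rewrite /bump !leq0n !add1n /= negbK; case: ifP => // _.
rewrite [LHS]big_mkcond 2!big_ord_recl /= !mul1r [RHS]big_mkcond.
apply: eq_bigr => k _; rewrite /bump !leq0n !add1n /= !eqSS; case: ifP => // _.
by rewrite !mxE !matching_lift_lift.
Qed.

(** A matching is the partner of the smallest index together with a matching of
    the other indices. *)
Lemma Pf_recl n (M : 'M[S]_n.+2) :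
  Pf M = \sum_(j < n.+1) (-1) ^+ j * (M ord0 (lift ord0 j) *
    Pf (\matrix_(a, b) M (lift ord0 (lift j a)) (lift ord0 (lift j b)))).
Proof.
rewrite /Pf /= negbK; case: ifP => _.
  by rewrite big1 // => j _; rewrite !mulr0.
under [RHS]eq_bigr => j _ do rewrite !mulr_sumr.
rewrite pair_big_dep /=.
rewrite (reindex_onto (fun p : 'I_n.+1 * 'S_n => matching_lift p.1 p.2)
  (fun s => odflt (ord0, 1%g) [pick p | matching_lift p.1 p.2 == s])) /=; last first.
  move=> s /matching_liftE[j [t def_s]]; case: pickP => [p /eqP //|].
  by move/(_ (j, t)); rewrite -def_s eqxx.
apply: eq_big => [[j t]|[j t] _] /=.
  rewrite matching_liftP andbC; case: pickP => [[j' t'] /eqP/matching_lift_inj -> |].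
    by rewrite eqxx.
  by move/(_ (j, t)); rewrite eqxx.
rewrite matching_lift_odd; have := matching_lift_prod M j t.
by rewrite /pairs_prod => ->; rewrite -mulrA; congr (_ * _); rewrite mulrCA.
Qed.

Lemma PfE n (M : 'M[S]_n) : Pf M = pfl (fun_of_matrix M) (enum 'I_n).
Proof.
have [p] := ubnP n; elim: p n M => // p IHp [|[|n]] M le_p.
- have -> : enum 'I_0 = [::] by apply: size0nil; rewrite size_enum_ord.
  rewrite /Pf /= (bigD1 (1%g : 'S_0)) /=; last by apply/forallP => -[].
  rewrite odd_perm1 mul1r big_ord0 big1 ?addr0 // => s /andP[_ /eqP[]].
  by apply/permP => -[].
- by rewrite pfl_odd ?size_enum_ord.
rewrite Pf_recl enum_ordSl pfl_cons contract_enum; apply: eq_bigr => j _.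
rewrite -map_del del_enum -map_comp IHp; last by lia.
rewrite (pfl_map (lift ord0 \o lift j)); congr (_ * (_ * _)).
by apply: eq_pfl => a b; rewrite mxE.
Qed.

Lemma PfSE n (M : 'M[S]_n) (A : {set 'I_n}) : PfS M A = pfl (fun_of_matrix M) (enum A).
Proof.
have -> : enum A = map (@enum_val _ (mem A)) (enum 'I_#|A|).
  case: (pickP (mem A)) => [x0 Ax0|A0]; last first.
    have A0' : A = set0 by apply/setP => x; rewrite inE; have := A0 x.
    have -> : enum A = [::] by rewrite A0' enum_set0.
    by apply/esym/size0nil; rewrite size_map size_enum_ord A0' cards0.
  apply: (@eq_from_nth _ x0); first by rewrite size_map size_enum_ord cardE.
  move=> i; rewrite -cardE => lt_i.
  rewrite (nth_map (Ordinal lt_i)) ?size_enum_ord // (nth_ord_enum _ (Ordinal lt_i)).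
  by rewrite (enum_val_nth x0).
by rewrite pfl_map /PfS PfE; apply: eq_pfl => a b; rewrite mxE.
Qed.

End PfaffianExpansion.


(** * Complexes with null-homotopic multiplications *)

Section IdealLemmas.
Variable R : comNzRingType.
Implicit Types (s : seq R) (x y a : R).

Lemma in_ideal0 s : in_ideal s 0.
Proof. by apply/ideal_predP; rewrite rpred0. Qed.

Lemma in_idealD s x y : in_ideal s x -> in_ideal s y -> in_ideal s (x + y).
Proof. by move=> /ideal_predP sx /ideal_predP sy; apply/ideal_predP/rpredD. Qed.

Lemma in_idealB s x y : in_ideal s x -> in_ideal s y -> in_ideal s (x - y).
Proof. by move=> /ideal_predP sx /ideal_predP sy; apply/ideal_predP/rpredB. Qed.

Lemma in_idealM s a x : in_ideal s x -> in_ideal s (a * x).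
Proof. by move=> /ideal_predP sx; apply/ideal_predP/ideal_predM. Qed.

Lemma in_ideal_sum s I (r : seq I) (P : pred I) (F : I -> R) :
  (forall i, P i -> in_ideal s (F i)) -> in_ideal s (\sum_(i <- r | P i) F i).
Proof.
by move=> sF; apply: big_ind => //; [apply: in_ideal0 | apply: in_idealD].
Qed.

Lemma in_ideal_nth s i : (i < size s)%N -> in_ideal s s`_i.
Proof.
move=> lt_i; exists (fun k => (k == Ordinal lt_i)%:R).
rewrite (bigD1 (Ordinal lt_i)) //= eqxx mul1r big1 ?addr0 // => k /negPf ->.
by rewrite mul0r.
Qed.

Lemma in_ideal_mem s x : x \in s -> in_ideal s x.
Proof. by move=> sx; rewrite -(nth_index 0 sx); apply: in_ideal_nth; rewrite index_mem. Qed.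

Lemma in_ideal_min s (Q : R -> Prop) x :
  Q 0 -> (forall y z, Q y -> Q z -> Q (y + z)) ->
  (forall a y, y \in s -> Q (a * y)) -> in_ideal s x -> Q x.
Proof.
move=> Q0 QD QM [a ->]; apply: big_ind => // i _.
by apply/QM/mem_nth.
Qed.

Lemma in_ideal_sub s s' x :
  {in s, forall y, in_ideal s' y} -> in_ideal s x -> in_ideal s' x.
Proof.
move=> ss'; apply: in_ideal_min; [exact: in_ideal0 | exact: in_idealD |].
by move=> a y /ss'; apply: in_idealM.
Qed.

Lemma in_ideal_nil x : in_ideal [::] x -> x = 0.
Proof. by case=> a ->; rewrite big_ord0. Qed.

Lemma in_ideal_rcons s z x :
  in_ideal (rcons s z) x <-> exists t, in_ideal s (x - t * z).
Proof.
split.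
  apply: (@in_ideal_min _ (fun x => exists t, in_ideal s (x - t * z))).
  - by exists 0; rewrite mul0r subr0; apply: in_ideal0.
  - move=> y y' [t st] [t' st']; exists (t + t').
    by rewrite mulrDl opprD addrACA; apply: in_idealD.
  move=> a y; rewrite mem_rcons inE => /predU1P[-> | sy].
    by exists a; rewrite subrr; apply: in_ideal0.
  by exists 0; rewrite mul0r subr0; apply/in_idealM/in_ideal_mem.
case=> t st; rewrite -[x](subrK (t * z)); apply: in_idealD.
  by apply: in_ideal_sub st => y sy; apply: in_ideal_mem; rewrite mem_rcons inE sy orbT.
by apply/in_idealM/in_ideal_mem; rewrite mem_rcons mem_head.
Qed.

(** The half of the definition of a regular sequence that does not exclude the
    unit ideal. *)
Definition weakly_regular (xs : seq R) : Prop :=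
  forall i, (i < size xs)%N ->
    forall y, in_ideal (take i xs) (xs`_i * y) -> in_ideal (take i xs) y.

Definition vec_in s p (v : 'cV[R]_p) : Prop := forall i, in_ideal s (v i 0).

Lemma vec_inD s p (v w : 'cV[R]_p) : vec_in s v -> vec_in s w -> vec_in s (v + w).
Proof. by move=> sv sw i; rewrite mxE; apply: in_idealD. Qed.

Lemma vec_inM s p q (A : 'M[R]_(p, q)) (v : 'cV[R]_q) : vec_in s v -> vec_in s (A *m v).
Proof. by move=> sv i; rewrite mxE; apply: in_ideal_sum => j _; apply: in_idealM. Qed.

Lemma vec_in_rcons s z p (v : 'cV[R]_p) :
  vec_in (rcons s z) v <-> exists t, vec_in s (v - z *: t).
Proof.
split=> [sv | [t st] i].
  have /fin_all_exists[t st] i : exists t, in_ideal s (v i 0 - t * z).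
    by apply/in_ideal_rcons.
  by exists (\col_i t i) => i; rewrite !mxE mulrC.
by apply/in_ideal_rcons; exists (t i 0); have := st i; rewrite !mxE mulrC.
Qed.

Lemma weakly_regular_vec xs j p (v : 'cV[R]_p) : weakly_regular xs ->
  (j < size xs)%N -> vec_in (take j xs) (xs`_j *: v) -> vec_in (take j xs) v.
Proof.
by move=> reg lt_j sv i; apply: reg => //; have := sv i; rewrite mxE.
Qed.

End IdealLemmas.

Section Complexes.
Variables (R : comNzRingType) (K : nat -> nat).
Variable (d : forall i, 'M[R]_(K i, K i.+1)).

(** A homotopy from multiplication by x to zero in positive degrees; in degree 0
    a resolution is not exact. *)
Definition null_homotopic x : Prop :=
  exists h : forall i, 'M[R]_(K i.+1, K i),
    forall i, d i.+1 *m h i.+1 + h i *m d i = x%:M.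

Hypothesis dd0 : forall i, d i *m d i.+1 = 0.

(** The acyclicity lemma.  A cycle v becomes a boundary after multiplication by
    x_j, say x_j v = d (h v) modulo the earlier x's; then h v is a cycle modulo
    one more x, hence by induction a boundary d w' + x_j t there, and x_j v = x_j d t.
    The recursion ends because the complex is shorter than the sequence. *)
Lemma acyclic_mod (top : nat) (xs : seq R) :
    (forall i, (top < i)%N -> K i = 0%N) ->
    weakly_regular xs -> {in xs, forall x, null_homotopic x} ->
  forall j i (v : 'cV[R]_(K i.+1)), (j <= size xs)%N ->
    (top < i.+1 + (size xs - j))%N -> vec_in (take j xs) (d i *m v) ->
    exists w, vec_in (take j xs) (v - d i.+1 *m w).
Proof.
move=> K0 reg_xs htp_xs j i v le_j; have [n] := ubnP (size xs - j)%N.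
elim: n j i v le_j => // n IHn j i v le_j lt_n lt_top cyc_v.
have [lt_j|ge_j] := ltnP j (size xs); last first.
  have K0i : K i.+1 = 0%N by apply: K0; lia.
  by exists 0 => k; case: (k) => k' lt_k'; exfalso; rewrite K0i in lt_k'.
have [h htp] := htp_xs _ (mem_nth 0 lt_j); set x := xs`_j in htp *.
have xv (u : 'cV_(K i.+1)) : x *: u = d i.+1 *m (h i.+1 *m u) + h i *m (d i *m u).
  by rewrite !mulmxA -mulmxDl htp mul_scalar_mx.
have def_x : take j.+1 xs = rcons (take j xs) x by apply: take_nth.
have lt_n' : (size xs - j.+1 < n)%N by lia.
have lt_top' : (top < i.+2 + (size xs - j.+1))%N by lia.
have [|w' Hw'] := IHn j.+1 i.+1 (h i.+1 *m v) lt_j lt_n' lt_top'.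
  rewrite def_x; apply/vec_in_rcons; exists v.
  rewrite -[X in vec_in _ X]opprK opprB xv addrAC subrr add0r -mulmxN.
  by apply: vec_inM => k; rewrite mxE -mulN1r; apply/in_idealM/cyc_v.
move: Hw'; rewrite def_x => /vec_in_rcons[t Ht]; exists t.
apply: (weakly_regular_vec reg_xs lt_j); rewrite -/x scalerBr xv.
rewrite addrAC; apply: vec_inD; last exact: vec_inM.
have -> : d i.+1 *m (h i.+1 *m v) - x *: (d i.+1 *m t) =
    d i.+1 *m (h i.+1 *m v - d i.+2 *m w' - x *: t).
  by rewrite !mulmxBr mulmxA (mulmxA (d i.+1)) dd0 mul0mx subr0 scalemxAr.
exact: vec_inM.
Qed.

Lemma acyclic (top : nat) (xs : seq R) i (v : 'cV[R]_(K i.+1)) :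
    (forall i, (top < i)%N -> K i = 0%N) -> weakly_regular xs ->
    {in xs, forall x, null_homotopic x} -> (top < i.+1 + size xs)%N ->
  d i *m v = 0 -> exists w, v = d i.+1 *m w.
Proof.
move=> K0 reg_xs htp_xs lt_top cyc_v.
have [|||w Hw] := acyclic_mod K0 reg_xs htp_xs (j := 0) (i := i) (v := v).
- by [].
- by rewrite subn0.
- by rewrite cyc_v => k; rewrite mxE; apply: in_ideal0.
exists w; apply/eqP; rewrite -subr_eq0; apply/eqP/matrixP => k l.
by have := Hw k; rewrite take0 (ord1 l) => /in_ideal_nil->; rewrite mxE.
Qed.

End Complexes.

(** * Projective dimension *)

Section Projective.
Variable R : comNzRingType.

Section Image.
Variables (U V : lmodType R) (f : {linear U -> V}).

Definition image_pred : {pred V} := [pred v | `[< exists u, f u = v >]].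

Lemma image_predP v : reflect (exists u, f u = v) (v \in image_pred).
Proof. exact: asboolP. Qed.

Lemma image_submod : submod_closed image_pred.
Proof.
split; first by apply/image_predP; exists 0; rewrite linear0.
move=> a _ _ /image_predP[u <-] /image_predP[v <-]; apply/image_predP.
by exists (a *: u + v); rewrite linearP.
Qed.

HB.instance Definition _ := GRing.isSubmodClosed.Build R V image_pred image_submod.

(** Projectivity speaks of surjections onto a module; the image of a map has to
    be made one. *)
Record image_module := ImageModule { image_val : V; _ : image_val \in image_pred }.

HB.instance Definition _ := [isSub for image_val].
HB.instance Definition _ := [Choice of image_module by <:].
HB.instance Definition _ := [SubChoice_isSubLmodule of image_module by <:].

End Image.

Lemma projective_lift (P M N : lmodType R) (g : {linear M -> N}) (f : {linear P -> N}) :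
  projective P -> (forall x, exists w, g w = f x) ->
  exists h : {linear P -> M}, forall x, g (h x) = f x.
Proof.
move=> projP gf.
have gin w : g w \in image_pred g by apply/image_predP; exists w.
have fin x : f x \in image_pred g by apply/image_predP.
pose g1 w := ImageModule (gin w); pose f1 x := ImageModule (fin x).
have g1_lin : linear g1 by move=> a u v; apply: val_inj; rewrite /= !linearP.
have f1_lin : linear f1 by move=> a u v; apply: val_inj; rewrite /= !linearP.
pose g1L : {linear M -> image_module g} := HB.pack g1 (GRing.isLinear.Build _ _ _ _ g1 g1_lin).
pose f1L : {linear P -> image_module g} := HB.pack f1 (GRing.isLinear.Build _ _ _ _ f1 f1_lin).
have surj : surjective_map g1L.
  move=> [z gz]; have /image_predP[w def_z] := gz.
  by exists w; apply: val_inj.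
have [h Hh] := projP _ _ g1L f1L surj.
by exists h => x; have /(congr1 val) := Hh x.
Qed.

Definition lincomb (M : lmodType R) n (b : 'I_n -> M) (v : 'cV[R]_n) : M :=
  \sum_i v i 0 *: b i.

Lemma lincomb_linear (M : lmodType R) n (b : 'I_n -> M) : linear (lincomb b).
Proof.
move=> a u v; rewrite /lincomb scaler_sumr -big_split; apply: eq_bigr => i _.
by rewrite !mxE scalerDl scalerA.
Qed.

HB.instance Definition _ (M : lmodType R) n (b : 'I_n -> M) :=
  GRing.isLinear.Build R 'cV[R]_n M _ (lincomb b) (lincomb_linear b).

Lemma linear_lincomb (M : lmodType R) n (f : {linear 'cV[R]_n -> M}) v :
  f v = lincomb (fun i => f (delta_mx i 0)) v.
Proof.
rewrite {1}[v]matrix_sum_delta linear_sum; apply: eq_bigr => i _.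
by rewrite big_ord1 linearZ.
Qed.

Lemma projective_free n : projective 'cV[R]_n.
Proof.
move=> M N g f surj_g.
have /fin_all_exists[b gb] i : exists w, g w = f (delta_mx i 0) by apply: surj_g.
exists (lincomb b) => x; rewrite (linear_lincomb f) /lincomb linear_sum.
by apply: eq_bigr => i _; rewrite linearZ gb.
Qed.

Definition cyclic_aug (s : seq R) (v : 'cV[R]_1) : cyclic_module s := cyclic_pi s (v 0 0).

Lemma cyclic_aug_linear (s : seq R) : linear (@cyclic_aug s).
Proof.
by move=> a u v; rewrite /cyclic_aug !mxE raddfD /=; congr (_ + _); rewrite -cyclic_scale_pi.
Qed.

HB.instance Definition _ (s : seq R) :=
  GRing.isLinear.Build R 'cV[R]_1 (cyclic_module s) _
    (@cyclic_aug s) (cyclic_aug_linear s).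

End Projective.

(** * Resolutions of length three *)

Section LengthThree.
Variables (R : comNzRingType) (r1 r2 r3 : nat).
Variables (d1 : 'M[R]_(1, r1)) (d2 : 'M[R]_(r1, r2)) (d3 : 'M[R]_(r2, r3)).

Definition res_rank i := nth 0%N [:: 1; r1; r2; r3]%N i.

Definition res_diff i : 'M[R]_(res_rank i, res_rank i.+1) :=
  match i with 0 => d1 | 1 => d2 | 2 => d3 | _ => 0 end.

(** The transposed complex is shifted by one, so that its first term is in
    degree 1 and [acyclic] covers it. *)
Definition dual_rank i := nth 0%N [:: 0; r3; r2; r1; 1]%N i.

Definition dual_diff i : 'M[R]_(dual_rank i, dual_rank i.+1) :=
  match i with 0 => 0 | 1 => d3^T | 2 => d2^T | 3 => d1^T | _ => 0 end.

(** Unlike [null_homotopic] this includes degree 0, as is required for the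
    transposed complex. *)
Definition null_homotopic3 x : Prop := exists h0 h1 h2,
  [/\ d1 *m h0 = x%:M, d2 *m h1 + h0 *m d1 = x%:M,
      d3 *m h2 + h1 *m d2 = x%:M & h2 *m d3 = x%:M].

Lemma null_homotopic_res_diff x : null_homotopic3 x -> null_homotopic res_diff x.
Proof.
case=> h0 [h1 [h2 [_ H1 H2 H3]]].
pose h i : 'M[R]_(res_rank i.+1, res_rank i) :=
  match i with 0 => h0 | 1 => h1 | 2 => h2 | _ => 0 end.
exists h => -[|[|[|i]]] //=.
  by rewrite mul0mx add0r.
by apply/matrixP; case=> k; rewrite /res_rank /= nth_nil.
Qed.

Lemma null_homotopic_dual_diff x : null_homotopic3 x -> null_homotopic dual_diff x.
Proof.
case=> h0 [h1 [h2 [H0 H1 H2 H3]]].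
pose h i : 'M[R]_(dual_rank i.+1, dual_rank i) :=
  match i with 0 => 0 | 1 => h2^T | 2 => h1^T | 3 => h0^T | _ => 0 end.
exists h => -[|[|[|[|i]]]] /=.
- by rewrite mul0mx addr0 -trmx_mul H3 tr_scalar_mx.
- by rewrite -(tr_scalar_mx _ x) -H2 raddfD /= !trmx_mul addrC.
- by rewrite -(tr_scalar_mx _ x) -H1 raddfD /= !trmx_mul addrC.
- by rewrite mul0mx add0r -trmx_mul H0 tr_scalar_mx.
by apply/matrixP; case=> k; rewrite /dual_rank /= nth_nil.
Qed.

Hypotheses (d12 : d1 *m d2 = 0) (d23 : d2 *m d3 = 0).

Lemma res_diff_comp i : res_diff i *m res_diff i.+1 = 0.
Proof. by case: i => [|[|[|i]]] //=; rewrite ?mulmx0 ?mul0mx. Qed.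

Lemma dual_diff_comp i : dual_diff i *m dual_diff i.+1 = 0.
Proof.
by case: i => [|[|[|[|i]]]] //=; rewrite ?mulmx0 ?mul0mx // -trmx_mul ?d12 ?d23 trmx0.
Qed.

Lemma exact3 (xs : seq R) : weakly_regular xs -> size xs = 3 ->
    {in xs, forall x, null_homotopic3 x} ->
  [/\ forall v : 'cV_r3, d3 *m v = 0 -> v = 0,
      forall v : 'cV_r2, d2 *m v = 0 <-> exists w, v = d3 *m w
    & forall v : 'cV_r1, d1 *m v = 0 <-> exists w, v = d2 *m w].
Proof.
move=> reg sz htp.
have ex i (v : 'cV_(res_rank i.+1)) : res_diff i *m v = 0 -> exists w, v = res_diff i.+1 *m w.
  apply: (@acyclic _ _ _ res_diff_comp 3 xs) => //; last by rewrite sz; lia.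
    by case=> [|[|[|[|k]]]] //; rewrite /res_rank /= nth_nil.
  by move=> x /htp/null_homotopic_res_diff.
split=> v.
- by case/(ex 2) => w ->; rewrite /= mul0mx.
- by split=> [/(ex 1)//|[w ->]]; rewrite mulmxA d23 mul0mx.
- by split=> [/(ex 0)//|[w ->]]; rewrite mulmxA d12 mul0mx.
Qed.

Section Exact.
Hypothesis inj3 : forall v : 'cV_r3, d3 *m v = 0 -> v = 0.
Hypothesis ex2 : forall v : 'cV_r2, d2 *m v = 0 -> exists w, v = d3 *m w.
Hypothesis ex1 : forall v : 'cV_r1, d1 *m v = 0 -> exists w, v = d2 *m w.

Lemma lift_columns p q n (A : 'M[R]_(n, p)) (B : 'M[R]_(p, q)) k (X : 'M[R]_(p, k)) :
  (forall v : 'cV_p, A *m v = 0 -> exists w, v = B *m w) ->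
  A *m X = 0 -> exists Y, X = B *m Y.
Proof.
move=> exAB AX0.
have /fin_all_exists[y Hy] j : exists w, col j X = B *m w.
  by apply: exAB; rewrite colE mulmxA AX0 mul0mx.
exists (\matrix_(i, j) y j i 0); apply/matrixP => i j.
have /colP/(_ i) := Hy j; rewrite !mxE => ->; apply: eq_bigr => l _.
by rewrite mxE.
Qed.

(** The homotopy is the lift of x to the first term, continued by exactness. *)
Lemma null_homotopic3_ideal x w : x%:M = d1 *m w -> null_homotopic3 x.
Proof.
move=> H0; have [h1 H1] : exists h1, x%:M - w *m d1 = d2 *m h1.
  apply: (lift_columns ex1).
  by rewrite mulmxBr mulmxA -H0 mul_mx_scalar mul_scalar_mx subrr.
have [h2 H2] : exists h2, x%:M - h1 *m d2 = d3 *m h2.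
  apply: (lift_columns ex2).
  by rewrite mulmxBr mulmxA -H1 mulmxBl -mulmxA d12 mulmx0 subr0 mul_mx_scalar mul_scalar_mx subrr.
exists w, h1, h2; split; rewrite -?H0 //.
- by rewrite -H1 subrK.
- by rewrite -H2 subrK.
apply/matrixP => i j; apply/eqP; rewrite -subr_eq0; apply/eqP.
have E : d3 *m (h2 *m d3 - x%:M) = 0.
  rewrite mulmxBr mulmxA -H2 mulmxBl -mulmxA d23 mulmx0 subr0.
  by rewrite mul_mx_scalar mul_scalar_mx subrr.
have /inj3/colP/(_ i) : d3 *m col j (h2 *m d3 - x%:M) = 0.
  by rewrite colE mulmxA E mul0mx.
by rewrite !mxE.
Qed.

(** If four elements of the ideal were regular, the dual complex would be exact
    at its end too, so that d3 would split. *)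
Lemma regular_size_le3 (xs : seq R) : weakly_regular xs ->
    {in xs, forall x, exists w, x%:M = d1 *m w} ->
  (3 < size xs)%N -> exists Y, Y *m d3 = 1%:M.
Proof.
move=> reg Ixs gt3.
have ex (v : 'cV_r3) : (0 : 'M_(0, r3)) *m v = 0 -> exists w, v = d3^T *m w.
  apply: (@acyclic _ _ _ dual_diff_comp 4 xs 0) => //.
    by case=> [|[|[|[|[|k]]]]] //; rewrite /dual_rank /= nth_nil.
  by move=> x /Ixs[w /null_homotopic3_ideal/null_homotopic_dual_diff].
have [|Y HY] := lift_columns ex (X := 1%:M); first by rewrite mul0mx.
by exists Y^T; rewrite -[d3]trmxK -trmx_mul -HY trmx1.
Qed.

Section CyclicModule.
Variable s : seq R.
Hypothesis ex0 : forall x, cyclic_pi s x = 0 <-> exists w, x%:M = d1 *m w.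

Lemma cyclic_augP (v : 'cV_1) : cyclic_aug s v = 0 <-> exists w, v = d1 *m w.
Proof. by rewrite {2}[v]mx11_scalar; apply: ex0. Qed.

Lemma proj_dim_le3 : proj_dim_le (cyclic_module s) 3.
Proof.
exists (fun i => 'cV[R]_(res_rank i) : lmodType R).
exists (fun i => mulmx (res_diff i) : {linear 'cV[R]_(res_rank i.+1) -> 'cV[R]_(res_rank i)}).
exists (@cyclic_aug _ s); split.
- by move=> i; apply: projective_free.
- move=> i gt3 x; apply/colP; case=> k lt_k; exfalso.
  by move: lt_k; rewrite /res_rank nth_default.
- move=> z; have [x <-] := cyclic_pi_surj z; exists (x%:M : 'cV_1).
  by rewrite /= /cyclic_aug mxE eqxx mulr1n.
- exact: cyclic_augP.
case=> [|[|[|i]]] x.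
- by split=> [/ex1//|[w ->]]; rewrite /= mulmxA d12 mul0mx.
- by split=> [/ex2//|[w ->]]; rewrite /= mulmxA d23 mul0mx.
- by split=> [/inj3->|[w ->]]; [exists 0; rewrite /= mulmx0 | rewrite /= mul0mx mulmx0].
split=> _; last by rewrite /= mul0mx.
exists 0; apply/colP; case=> k lt_k; exfalso.
by move: lt_k; rewrite /res_rank /= nth_nil.
Qed.

(** A projective resolution P of length at most two would be compared with the
    free one by chain maps in both directions; their composite is homotopic to
    the identity and factors through P 3 = 0 in degree three, so that d3 would
    split. *)
Lemma proj_dim_ge3 d' : (forall Y, Y *m d3 <> 1%:M) ->
  proj_dim_le (cyclic_module s) d' -> (3 <= d')%N.
Proof.
move=> nsplit [P [D [e [projP P0 surj_e exe exD]]]]; rewrite leqNgt; apply/negP => lt_d'.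
have D0 i y : D i (D i.+1 y) = 0 by apply/exD; exists y.
have eD y : e (D 0%N y) = 0 by apply/exe; exists y.
have augd w : cyclic_aug s (d1 *m w) = 0 by apply/cyclic_augP; exists w.
have projF n := @projective_free R n.
have [a0 Ha0] := projective_lift (g := e) (f := @cyclic_aug _ s) (projF _)
  (fun x => surj_e _).
have [|a1 Ha1] := projective_lift (g := D 0%N)
  (f := (a0 \o mulmx d1 : {linear _ -> _})) (projF _).
  move=> x; have /exe[y def_y] : e (a0 (d1 *m x)) = 0 by rewrite Ha0; apply: augd.
  by exists y; rewrite /= -def_y.
rewrite /= in Ha1.
have [|a2 Ha2] := projective_lift (g := D 1%N)
  (f := (a1 \o mulmx d2 : {linear _ -> _})) (projF _).
  move=> x; have /exD[y def_y] : D 0%N (a1 (d2 *m x)) = 0.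
    by rewrite Ha1 mulmxA d12 mul0mx linear0.
  by exists y; rewrite /= -def_y.
rewrite /= in Ha2.
have [|b0 Hb0] := projective_lift (g := @cyclic_aug _ s) (f := e) (projP 0%N).
  by move=> y; have [x <-] := cyclic_pi_surj (e y); exists (x%:M : 'cV_1);
    rewrite /= /cyclic_aug mxE eqxx mulr1n.
have [|b1 Hb1] := projective_lift (g := mulmx d1)
  (f := (b0 \o D 0%N : {linear _ -> _})) (projP 1%N).
  move=> y; have /cyclic_augP[w def_w] : cyclic_aug s (b0 (D 0%N y)) = 0 by rewrite Hb0 eD.
  by exists w; rewrite /= -def_w.
rewrite /= in Hb1.
have [|b2 Hb2] := projective_lift (g := mulmx d2)
  (f := (b1 \o D 1%N : {linear _ -> _})) (projP 2).
  move=> y; have /ex1[w def_w] : d1 *m (b1 (D 1%N y)) = 0 by rewrite Hb1 D0 linear0.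
  by exists w; rewrite /= -def_w.
rewrite /= in Hb2.
have [|s0 Hs0] := projective_lift (g := mulmx d1)
  (f := (idfun \- (b0 \o a0) : {linear _ -> _})) (projF 1%N).
  move=> x; have /cyclic_augP[w def_w] : cyclic_aug s (x - b0 (a0 x)) = 0.
    by rewrite linearB /= Hb0 Ha0 subrr.
  by exists w; rewrite /= -def_w.
rewrite /= in Hs0.
have [|s1 Hs1] := projective_lift (g := mulmx d2)
  (f := (idfun \- (b1 \o a1) \- (s0 \o mulmx d1) : {linear _ -> _})) (projF r1).
  move=> x; have /ex1[w def_w] : d1 *m (x - b1 (a1 x) - s0 (d1 *m x)) = 0.
    by rewrite !mulmxBr Hb1 Ha1 Hs0 subrr.
  by exists w; rewrite /= -def_w.
rewrite /= in Hs1.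
have [|s2 Hs2] := projective_lift (g := mulmx d3)
  (f := (idfun \- (b2 \o a2) \- (s1 \o mulmx d2) : {linear _ -> _})) (projF r2).
  move=> x; have /ex2[w def_w] : d2 *m (x - b2 (a2 x) - s1 (d2 *m x)) = 0.
    rewrite !mulmxBr Hb2 Ha2 Hs1 mulmxA d12 mul0mx linear0 subr0.
    by rewrite subrr.
  by exists w; rewrite /= -def_w.
rewrite /= in Hs2.
have a2d x : a2 (d3 *m x) = 0.
  have /exD[y def_y] : D 1%N (a2 (d3 *m x)) = 0 by rewrite Ha2 mulmxA d23 mul0mx linear0.
  by rewrite def_y (P0 3 lt_d' y) linear0.
have s2d x : s2 (d3 *m x) = x.
  apply/eqP; rewrite -subr_eq0; apply/eqP/inj3.
  by rewrite mulmxBr Hs2 a2d mulmxA d23 mul0mx !linear0 !addr0 subrr.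
apply: (nsplit (\matrix_(i, j) s2 (delta_mx j 0) i 0)).
apply/matrixP => i j; have := congr1 (fun v : 'cV_r3 => v i 0) (s2d (delta_mx j 0)).
rewrite -colE (linear_lincomb s2) /lincomb summxE mxE => E.
rewrite !mxE; rewrite eqxx andbT in E; rewrite -E; apply: eq_bigr => k _.
by rewrite !mxE mulrC.
Qed.

End CyclicModule.
End Exact.
End LengthThree.


(** * Regular sequences from initial monomials *)

Section InitialMonomials.
Variables (n : nat) (R : comNzRingType) (mf : measure n).
Local Notation A := {mpoly R[n]}.
Implicit Types (p q r : A) (mu nu al : 'X_{1..n}).

Definition below k p := forall nu, nu \in msupp p -> (mf nu < k)%N.

Lemma below0 k : below k 0.
Proof. by move=> nu; rewrite msupp0. Qed.

Lemma belowD k p q : below k p -> below k q -> below k (p + q).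
Proof. by move=> bp bq nu /msuppD_le; rewrite mem_cat => /orP[/bp|/bq]. Qed.

Lemma belowN k p : below k p -> below k (- p).
Proof. by move=> bp nu; rewrite (perm_mem (msuppN p)) => /bp. Qed.

Lemma belowB k p q : below k p -> below k q -> below k (p - q).
Proof. by move=> bp bq; apply: belowD => //; apply: belowN. Qed.

Lemma belowZ k c p : below k p -> below k (c *: p).
Proof. by move=> bp nu /msuppZ_le/bp. Qed.

Lemma below_leq k l p : (k <= l)%N -> below k p -> below l p.
Proof. by move=> le_kl bp nu /bp lt_k; apply: leq_trans lt_k le_kl. Qed.

Lemma belowX mu : below (mf mu).+1 'X_[mu].
Proof. by move=> nu; rewrite msuppX inE => /eqP->. Qed.

Lemma belowM k l p q : below k.+1 p -> below l q -> below (k + l) (p * q).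
Proof.
move=> bp bq nu /msuppM_le /allpairsP[[a b] /= [/bp lt_a /bq lt_b ->]].
by rewrite mfD; lia.
Qed.

Lemma below_sum k I (s : seq I) (P : pred I) (F : I -> A) :
  (forall i, P i -> below k (F i)) -> below k (\sum_(i <- s | P i) F i).
Proof. by move=> bF; apply: big_ind => //; [apply: below0 | apply: belowD]. Qed.

(** The initial monomial has coefficient 1: no division is needed over an
    arbitrary ring. *)
Definition initial mu p := below (mf mu) (p - 'X_[mu]).

Lemma initial_below mu p : initial mu p -> below (mf mu).+1 p.
Proof.
by move=> ip; rewrite -[p](subrK 'X_[mu]); apply/belowD/belowX/below_leq/ip.
Qed.

Lemma initialX mu : initial mu 'X_[mu].
Proof. by rewrite /initial subrr; apply: below0. Qed.

Lemma initialM mu nu p q : initial mu p -> initial nu q -> initial (mu + nu)%MM (p * q).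
Proof.
move=> ip iq; rewrite /initial mpolyXD mfD.
have -> : p * q - 'X_[mu] * 'X_[nu] = p * (q - 'X_[nu]) + 'X_[nu] * (p - 'X_[mu]) by ring.
apply: belowD; first by apply: belowM => //; apply: initial_below.
by rewrite addnC; apply/belowM/ip/belowX.
Qed.

Section CoprimeInitials.
Variables (k : nat) (mus : 'I_k -> 'X_{1..n}) (fs : 'I_k -> A).
Hypothesis mus_neq0 : forall i, mus i != 0%MM.
Hypothesis mus_coprime : forall (i j : 'I_k) v, i != j -> (mus i v == 0%N) || (mus j v == 0%N).
Hypothesis fs_initial : forall i, initial (mus i) (fs i).

(** The argument d bounds the degree of al and makes the recursion structural. *)
Fixpoint subst_rec d al : A :=
  if d is d'.+1 then
    if [pick i | (mus i <= al)%MM] is Some i then fs i * subst_rec d' (al - mus i)%MM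
    else 'X_[al]
  else 'X_[al].

(** The monomial al with the mus, taken out of it as often as possible,
    replaced by the corresponding fs. *)
Definition subst_mon al := subst_rec (mdeg al) al.

Lemma lt_mdeg i al : (mus i <= al)%MM -> (mdeg (al - mus i)%MM < mdeg al)%N.
Proof.
move=> le_al; have := mdegD (al - mus i)%MM (mus i); rewrite submK // => ->.
by have := mus_neq0 i; rewrite -mdeg_eq0; lia.
Qed.

Lemma subst_recE d al : (mdeg al <= d)%N -> subst_rec d al = subst_mon al.
Proof.
have [b] := ubnP (mdeg al); elim: b al d => // b IHb al d le_b le_d.
rewrite /subst_mon; case: d le_d => [|d] le_d /=.
  by move: le_d; rewrite leqn0 => /eqP->.
case def_d': (mdeg al) => [|d'] /=; case: pickP => // i /lt_mdeg lt_i.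
  by rewrite def_d' in lt_i.
by congr (_ * _); rewrite !IHb //; lia.
Qed.

Lemma subst_monE al :
  subst_mon al = if [pick i | (mus i <= al)%MM] is Some i
                 then fs i * subst_mon (al - mus i)%MM else 'X_[al].
Proof.
rewrite {1}/subst_mon; case def_d: (mdeg al) => [|d] /=; case: pickP => // i /lt_mdeg lt_i.
  by rewrite def_d in lt_i.
by rewrite subst_recE //; lia.
Qed.

Lemma subst_mon_initial al : initial al (subst_mon al).
Proof.
have [b] := ubnP (mdeg al); elim: b al => // b IHb al le_b.
rewrite subst_monE; case: pickP => [i le_al|_]; last exact: initialX.
rewrite -{1}(submK le_al) addmC; apply: initialM => //.
by apply: IHb; have := lt_mdeg le_al; lia.
Qed.

Lemma coprime_lem i j al : i != j -> (mus j <= mus i + al)%MM -> (mus j <= al)%MM.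
Proof.
move=> neq_ij /mnm_lepP le_j; apply/mnm_lepP => v.
by have := le_j v; rewrite mnmDE; have /orP[] := mus_coprime v neq_ij => /eqP->.
Qed.

(** If another mu_j is extracted first, it divides al already, because it is
    coprime to mu_i. *)
Lemma subst_monD i al : subst_mon (mus i + al)%MM = fs i * subst_mon al.
Proof.
have [b] := ubnP (mdeg al); elim: b i al => // b IHb i al le_b.
rewrite subst_monE.
case: pickP => [j le_j|/(_ i)]; last by rewrite lem_addr.
have [<-|neq_ij] := eqVneq i j; first by rewrite addmC addmK.
have le_al : (mus j <= al)%MM := coprime_lem neq_ij le_j.
have lt_j := lt_mdeg le_al; rewrite -addmBA // IHb; last by lia.
rewrite -{2}(submK le_al) [in RHS]addmC IHb; last by lia.
by rewrite mulrCA.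
Qed.

Definition subst_lead p : A := \sum_(al <- msupp p) p@_al *: subst_mon al.

Lemma subst_leadE p d : (msize p <= d)%N ->
  subst_lead p = \sum_(al : 'X_{1..n < d}) p@_al *: subst_mon al.
Proof.
move=> le_d; set I : subFinType _ := 'X_{1..n < d}.
rewrite /subst_lead (big_mksub I) ?msupp_uniq //=; first last.
  by move=> x /msize_mdeg_lt /leq_trans; apply.
rewrite big_rmcond //= => j /memN_msupp_eq0 ->.
by rewrite scale0r.
Qed.

Lemma subst_leadD p q : subst_lead (p + q) = subst_lead p + subst_lead q.
Proof.
pose d := maxn (msize p) (msize q).
rewrite !(@subst_leadE _ d) ?leq_maxl ?leq_maxr ?msizeD_le //.
by rewrite -big_split; apply: eq_bigr => al _; rewrite mcoeffD scalerDl.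
Qed.

Lemma subst_leadZ c p : subst_lead (c *: p) = c *: subst_lead p.
Proof.
rewrite !(@subst_leadE _ (msize p)) ?mmeasureZ_le // scaler_sumr.
by apply: eq_bigr => al _; rewrite mcoeffZ scalerA.
Qed.

Lemma subst_lead0 : subst_lead 0 = 0.
Proof. by rewrite /subst_lead msupp0 big_nil. Qed.

Lemma subst_lead_sum I (s : seq I) (F : I -> A) :
  subst_lead (\sum_(i <- s) F i) = \sum_(i <- s) subst_lead (F i).
Proof. exact: (big_morph _ subst_leadD subst_lead0). Qed.

Lemma subst_leadX al : subst_lead 'X_[al] = subst_mon al.
Proof. by rewrite /subst_lead msuppX big_seq1 mcoeffX eqxx scale1r. Qed.

Lemma subst_leadM i p : subst_lead ('X_[mus i] * p) = fs i * subst_lead p.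
Proof.
rewrite {1}[p]mpolyE mulr_sumr subst_lead_sum mulr_sumr; apply: eq_bigr => al _.
by rewrite -scalerAr -mpolyXD subst_leadZ subst_leadX subst_monD scalerAr.
Qed.

(** Thus [subst_lead] is unitriangular for the filtration by weight. *)
Lemma subst_lead_below p : p != 0 -> (mmeasure mf (subst_lead p - p) < mmeasure mf p)%N.
Proof.
move=> nz_p; have -> : subst_lead p - p = \sum_(al <- msupp p) p@_al *: (subst_mon al - 'X_[al]).
  by rewrite {2}[p]mpolyE -sumrB; apply: eq_bigr => al _; rewrite scalerBr.
rewrite -(mmeasure_poly_eq0 mf) -lt0n in nz_p; rewrite -(prednK nz_p) ltnS.
rewrite mmeasureE; apply/bigmax_leqP_seq => nu nu_in _.
suff: below (mmeasure mf p).-1 (\sum_(al <- msupp p) p@_al *: (subst_mon al - 'X_[al])) by apply.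
rewrite big_seq; apply: below_sum => al /(mmeasure_mnm_lt mf) lt_al; apply: belowZ.
by apply: (below_leq _ (@subst_mon_initial al)); lia.
Qed.

Lemma subst_lead_inj p : subst_lead p = 0 -> p = 0.
Proof.
move=> Tp0; apply/eqP/negPn/negP => /subst_lead_below.
by rewrite Tp0 sub0r mmeasureN ltnn.
Qed.

Lemma subst_lead_surj q : exists p, subst_lead p = q.
Proof.
have [b] := ubnP (mmeasure mf q); elim: b q => // b IHb q le_b.
have [->|nz_q] := eqVneq q 0; first by exists 0; rewrite subst_lead0.
have [|p Tp] := IHb (q - subst_lead q).
  by rewrite -opprB mmeasureN; apply: leq_trans (subst_lead_below nz_q) _.
by exists (q + p); rewrite subst_leadD Tp addrC subrK.
Qed.

Lemma msuppXM mu p nu : nu \in msupp ('X_[mu] * p) ->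
  exists2 al, al \in msupp p & nu = (mu + al)%MM.
Proof. by rewrite mulrC (perm_mem (msuppMX p mu)) => /mapP. Qed.

Lemma in_ideal_monomials (s : seq 'X_{1..n}) p :
  in_ideal [seq 'X_[mu] | mu <- s] p <->
  forall al, al \in msupp p -> exists2 mu, mu \in s & (mu <= al)%MM.
Proof.
split=> [|dvd_p].
  apply: (@in_ideal_min _ _ (fun p =>
    forall al, al \in msupp p -> exists2 mu, mu \in s & (mu <= al)%MM)).
  - by move=> al; rewrite msupp0.
  - by move=> y z Qy Qz al /msuppD_le; rewrite mem_cat => /orP[/Qy|/Qz].
  move=> a _ /mapP[mu s_mu ->] al; rewrite mulrC => /msuppXM[be _ ->].
  by exists mu; rewrite ?lem_addr.
rewrite [p]mpolyE big_seq; apply: in_ideal_sum => al /dvd_p[mu s_mu le_al].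
rewrite -(submK le_al) mpolyXD scalerAl; apply/in_idealM/in_ideal_mem.
exact: map_f.
Qed.

(** Since [subst_lead] is a bijection that turns multiplication by the monomial
    mu_i into multiplication by f_i, it suffices that the mu_i form a regular
    sequence, which holds for coprime monomials. *)
Lemma weakly_regular_initial : weakly_regular [seq fs i | i <- enum 'I_k].
Proof.
have in_ideal_subst (s : seq 'I_k) p :
    in_ideal [seq fs i | i <- s] (subst_lead p) <-> in_ideal [seq 'X_[mus i] | i <- s] p.
  split; last first.
    apply: (@in_ideal_min _ _ (fun p => in_ideal _ (subst_lead p))).
    - by rewrite subst_lead0; apply: in_ideal0.
    - by move=> y z Qy Qz; rewrite subst_leadD; apply: in_idealD.
    move=> a _ /mapP[i s_i ->]; rewrite mulrC subst_leadM mulrC.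
    by apply/in_idealM/in_ideal_mem/map_f.
  suff: forall y, in_ideal [seq fs i | i <- s] y ->
      exists2 r, subst_lead r = y & in_ideal [seq 'X_[mus i] | i <- s] r.
    move=> H /H[r Tr Ir]; suff -> : p = r by [].
    apply/eqP; rewrite -subr_eq0; apply/eqP/subst_lead_inj.
    by rewrite -scaleN1r subst_leadD subst_leadZ Tr scaleN1r subrr.
  move=> y; apply: (@in_ideal_min _ _ (fun y => exists2 r, subst_lead r = y & in_ideal _ r)).
  - by exists 0; [apply: subst_lead0 | apply: in_ideal0].
  - move=> _ _ [r <- Ir] [r' <- Ir']; exists (r + r'); first exact: subst_leadD.
    exact: in_idealD.
  move=> a _ /mapP[i s_i ->]; have [b <-] := subst_lead_surj a.
  exists ('X_[mus i] * b); first by rewrite subst_leadM mulrC.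
  by rewrite mulrC; apply/in_idealM/in_ideal_mem/map_f.
move=> i; rewrite size_map size_enum_ord => lt_i y.
have [p <-] := subst_lead_surj y.
rewrite (nth_map (Ordinal lt_i)) ?size_enum_ord // (nth_ord_enum _ (Ordinal lt_i)).
rewrite -subst_leadM -map_take !in_ideal_subst.
have -> s : [seq 'X_[mus i] | i <- s] = [seq 'X_[mu] | mu <- map mus s] :> seq A.
  by rewrite -map_comp.
rewrite !in_ideal_monomials => dvd al al_in.
have [|mu] := dvd (mus (Ordinal lt_i) + al)%MM.
  by rewrite mulrC (perm_mem (msuppMX _ _)) map_f.
case/mapP=> j j_in -> le_j; exists (mus j); first exact: map_f.
apply: coprime_lem le_j; apply/eqP => eq_j; move: j_in; rewrite -eq_j.
by rewrite in_take_leq ?size_enum_ord ?index_enum_ord ?ltnn // ltnW.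
Qed.

End CoprimeInitials.
End InitialMonomials.


(** * The complex of a skew matrix with a zero block *)

Section SkewBlock.
Variables (S : comNzRingType) (m : nat).
Local Notation N := (2 * m).+1.
Variables (B : 'M[S]_(3, N)) (A : 'M[S]_N).
Hypotheses (A_skew : forall i j, A i j = - A j i) (A_diag : forall i, A i i = 0).

Definition skew_block : 'M[S]_(3 + N) := block_mx 0 B (- B^T) A.

Local Notation U := (fun_of_matrix skew_block).
Local Notation top := (@lshift 3 N).
Local Notation low := (@rshift 3 N).

Definition lows : seq 'I_(3 + N) := map low (enum 'I_N).
Local Notation L := lows.
Local Notation pfU := (pfl U).

Lemma U_top_top a b : skew_block (top a) (top b) = 0.
Proof. by rewrite block_mxEul mxE. Qed.

Lemma U_top_low a i : skew_block (top a) (low i) = B a i.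
Proof. by rewrite block_mxEur. Qed.

Lemma U_low_top a i : skew_block (low i) (top a) = - B a i.
Proof. by rewrite block_mxEdl !mxE. Qed.

Lemma U_low_low i j : skew_block (low i) (low j) = A i j.
Proof. by rewrite block_mxEdr. Qed.

Definition U_E := (U_top_top, U_top_low, U_low_top, U_low_low).

Lemma U_skew x y : skew_block x y = - skew_block y x.
Proof.
by case: (split_ordP x) => i ->; case: (split_ordP y) => j ->; rewrite !U_E ?oppr0 ?opprK.
Qed.

Lemma U_diag x : skew_block x x = 0.
Proof. by case: (split_ordP x) => i ->; rewrite U_E. Qed.

Definition top_pf k : S := pfU (top k :: L).
(** The signed maximal sub-Pfaffians of A, a vector in its kernel. *)
Definition low_pf (i : 'I_N) : S := (-1) ^+ i * pfU (del i L).

(** The lower block of the Pfaffian adjoint of A bordered by the row k of B. *)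
Definition low_pf2 k (i l : 'I_N) : S :=
  if unlift i l is Some l' then (-1) ^+ (i + l').+1 * pfU (top k :: del l' (del i L)) else 0.

Lemma del_lowsE (i : 'I_N) : del i L = map (low \o lift i) (enum 'I_(2 * m)).
Proof. by rewrite /lows -map_del del_enum -map_comp. Qed.

Lemma contract_lows (G : _ -> _ -> S) :
  contract G L = \sum_(i < N) (-1) ^+ i * G (low i) (del i L).
Proof. exact: contract_enum. Qed.

Lemma contract_del_lows (G : _ -> _ -> S) (i : 'I_N) : contract G (del i L) =
  \sum_(l < 2 * m) (-1) ^+ l * G (low (lift i l)) (del l (del i L)).
Proof. by rewrite del_lowsE contract_enum. Qed.

Lemma lows_del (i : 'I_N) : L = take i L ++ low i :: drop i.+1 L.
Proof.
have lt_i : (i < size L)%N by rewrite size_map size_enum_ord.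
rewrite -{1}(cat_take_drop i L) (drop_nth (low i)) //; congr (_ ++ _ :: _).
by rewrite (nth_map i) ?size_enum_ord // nth_ord_enum.
Qed.

Lemma sum_top_low_pf k : \sum_i B k i * low_pf i = top_pf k.
Proof.
rewrite /top_pf pfl_cons contract_lows; apply: eq_bigr => i _.
by rewrite U_E mulrCA.
Qed.

Lemma low_mem i : low i \in L.
Proof. by apply: map_f; rewrite mem_enum. Qed.

Lemma sum_low_low_pf j : \sum_i A j i * low_pf i = 0.
Proof.
have := pfl_mem U_skew U_diag (low_mem j); rewrite pfl_cons contract_lows => {2}<-.
by apply: eq_bigr => i _; rewrite U_E mulrCA.
Qed.

Lemma pfU_low_top (i j : 'I_N) k :
  pfU (low j :: top k :: del i L) = - (-1) ^+ i * (top_pf k *+ (i == j)).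
Proof.
have [<-|neq_ij] := eqVneq i j; last first.
  rewrite mulr0 pfl_mem //; [exact: U_skew | exact: U_diag |].
  rewrite inE del_lowsE; apply/orP; right; apply/mapP.
  have [l def_j|eq_ij] := unliftP i j; last by rewrite eq_ij eqxx in neq_ij.
  by exists l; rewrite ?mem_enum //= -def_j.
rewrite (pfl_swap U_skew [::]) /= /del.
rewrite (pfl_move U_skew [:: top k]) /= -lows_del size_take_min.
by rewrite size_map size_enum_ord (minn_idPl _) ?mulNr // ltnW.
Qed.

(** Half of the identity between the bordered matrix and its Pfaffian adjoint;
    the other half follows by transposition. *)
Lemma low_pf2_mul_low k (i j : 'I_N) :
  low_pf i * B k j + \sum_l low_pf2 k i l * A l j = top_pf k *+ (i == j).
Proof.
have -> : top_pf k *+ (i == j) = - (-1) ^+ i * pfU (low j :: top k :: del i L).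
  by rewrite pfU_low_top mulrA mulrNN -expr2 sqrr_sign mul1r.
rewrite pfl_cons contract_cons U_E contract_del_lows.
rewrite (bigD1_ord i) //= {1}/low_pf2 unlift_none mul0r add0r mulNr mulrBr opprB.
rewrite addrC; congr (_ + _); last by rewrite /low_pf; ring.
rewrite mulr_sumr; apply: eq_bigr => l _; rewrite /low_pf2 liftK U_E A_skew.
by rewrite exprS exprD; ring.
Qed.

Lemma low_pf2_skew k i l : low_pf2 k i l = - low_pf2 k l i.
Proof.
wlog lt_il : i l / (i < l)%N => [IH|].
  have [/IH//|/IH->|/val_inj->] := ltngtP i l; first by rewrite opprK.
  by rewrite /low_pf2 unlift_none oppr0.
rewrite /low_pf2; case: unliftP => [l' def_l|eq_li]; last by rewrite eq_li ltnn in lt_il.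
case: unliftP => [i' def_i|eq_il]; last by rewrite eq_il ltnn in lt_il.
have l'E : l = l'.+1 :> nat by move: lt_il; rewrite {1 2}def_l /= /bump; case: leqP; lia.
have i'E : i = i' :> nat by move: lt_il; rewrite {1 2}def_i /= /bump; case: leqP; lia.
have -> : del i' (del l L) = del l' (del i L).
  by rewrite -i'E l'E -del_del //; [lia | rewrite size_map size_enum_ord -l'E].
rewrite l'E -i'E (_ : (l'.+1 + i).+1 = (i + l').+2)%N; last by lia.
by rewrite [in RHS]exprS mulN1r mulNr opprK.
Qed.

Lemma sum_top_low_pf2 j k l :
  \sum_i B j i * low_pf2 k i l = - (-1) ^+ l * pfU (top j :: top k :: del l L).
Proof.
rewrite pfl_cons contract_cons U_E mul0r sub0r mulrNN contract_del_lows mulr_sumr.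
rewrite (bigD1_ord l) //= {1}/low_pf2 unlift_none mulr0 add0r.
apply: eq_bigr => i _; rewrite low_pf2_skew /low_pf2 liftK U_E exprS exprD; ring.
Qed.

Lemma sum_top_top2_pf k a b :
  \sum_l B k l * ((-1) ^+ l * pfU (top a :: top b :: del l L)) =
  pfU (top k :: top a :: top b :: L).
Proof.
rewrite pfl_cons !contract_cons !U_E !mul0r !sub0r opprK contract_lows.
by apply: eq_bigr => l _; rewrite U_E mulrCA.
Qed.


(** The upper indices are taken in cyclic order, so that the same formulas serve
    for the three values of k. *)
Lemma ord3_cases (k i : 'I_3) : [\/ i = k, i = ordS k | i = ordS (ordS k)].
Proof.
by case: k i => [[|[|[|]]] lt_k] // [[|[|[|]]] lt_i] //;
  ((by constructor 1; apply: val_inj) || (by constructor 2; apply: val_inj)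
   || (by constructor 3; apply: val_inj)).
Qed.

Lemma ord3_neq (k : 'I_3) : ((k == ordS k) = false) * ((k == ordS (ordS k)) = false) *
  ((ordS k == k) = false) * ((ordS (ordS k) == k) = false) *
  ((ordS k == ordS (ordS k)) = false) * ((ordS (ordS k) == ordS k) = false) *
  (ordS (ordS (ordS k)) = k).
Proof. by do ![split]; try apply: val_inj; case: k => [[|[|[|]]]]. Qed.

Definition pf_total : S := pfU [:: top 0, top (ordS 0), top (ordS (ordS 0)) & L].

Lemma pf_total_rot k : pfU [:: top k, top (ordS k), top (ordS (ordS k)) & L] = pf_total.
Proof.
have rot a b c : pfU [:: top b, top c, top a & L] = pfU [:: top a, top b, top c & L].
  by rewrite [RHS](pfl_move U_skew [::] (top a) [:: top b; top c]) /= sqrrN expr1n mul1r.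
rewrite /pf_total; case: (ord3_cases 0 k) => ->; first by [].
  by rewrite ord3_neq rot.
by rewrite !ord3_neq -rot.
Qed.

(** The maps of the resolution.  The basis elements of the rank 4 module that
    belong to G come in the order 3, 2, 1. *)
Definition res1 : 'M[S]_(1, 1 + 3) := row_mx pf_total%:M (\row_k top_pf (rev_ord k)).

Definition res2_cross : 'M[S]_3 := \matrix_(i, j)
  (top_pf (ordS (ordS (rev_ord i))) *+ (j == ordS (rev_ord i))
   - top_pf (ordS (rev_ord i)) *+ (j == ordS (ordS (rev_ord i)))).

Definition res2_low : 'M[S]_(3, N) := \matrix_(i, l)
  ((-1) ^+ l * pfU [:: top (ordS (rev_ord i)), top (ordS (ordS (rev_ord i))) & del l L]).

Definition res2 : 'M[S]_(1 + 3, 3 + N) :=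
  block_mx 0 (- \row_l low_pf l) res2_cross res2_low.

Definition res3 : 'M[S]_(3 + N, N) := col_mx B A.

Definition htp1_top (k : 'I_3) : 'M[S]_3 := \matrix_(i, j)
  (((i == ordS (ordS k)) && (j == rev_ord (ordS k)))%:R
   - ((i == ordS k) && (j == rev_ord (ordS (ordS k))))%:R).

(** The homotopy for the k-th of the three Pfaffians.  Its last component is the
    Pfaffian adjoint of A bordered by the row k of B; the others only involve
    constants and that row. *)
Definition htp0 (k : 'I_3) : 'M[S]_(1 + 3, 1) := col_mx 0 (delta_mx (rev_ord k) 0).
Definition htp1 (k : 'I_3) : 'M[S]_(3 + N, 1 + 3) :=
  block_mx 0 (htp1_top k) (- (row k B)^T) 0.
Definition htp2 (k : 'I_3) : 'M[S]_(N, 3 + N) :=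
  row_mx ((\col_l low_pf l) *m delta_mx 0 k) (\matrix_(i, l) low_pf2 k i l).

Lemma sum_delta (I : finType) (f : I -> S) a (b : bool) :
  \sum_c f c * ((c == a) && b)%:R = f a *+ b.
Proof.
rewrite (bigD1 a) //= eqxx big1 ?addr0 ?mulr_natr // => c /negPf->.
by rewrite mulr0.
Qed.

Lemma htp_deg0 k : res1 *m htp0 k = (top_pf k)%:M.
Proof.
rewrite mul_row_col mulmx0 add0r -colE; apply/matrixP => i j.
by rewrite !mxE !ord1 rev_ordK mulr1n.
Qed.

Lemma htp_deg3 k : htp2 k *m res3 = (top_pf k)%:M.
Proof.
rewrite mul_row_col -mulmxA -rowE; apply/matrixP => i j.
rewrite !mxE big_ord1 -low_pf2_mul_low !mxE; congr (_ + _).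
by apply: eq_bigr => l _; rewrite mxE.
Qed.

Lemma htp_deg1 k : res2 *m htp1 k + htp0 k *m res1 = (top_pf k)%:M.
Proof.
rewrite mulmx_block !mul0mx !mulmx0 !add0r !addr0 mul_col_row !mul0mx add_block_mx.
rewrite !addr0 scalar_mx_block; congr block_mx.
- apply/matrixP => i j; rewrite !mxE !ord1 mulr1n -sum_top_low_pf.
  by apply: eq_bigr => l _; rewrite !mxE mulrNN mulrC.
- apply/matrixP => i j; rewrite ord1 -[i]rev_ordK; move: (rev_ord i) => {}i.
  rewrite !mxE big_ord1 !mxE /= mulr1n (can_eq rev_ordK) andbT.
  under eq_bigr => l _ do rewrite !mxE rev_ordK mulrN mulrC.
  rewrite sumrN sum_top_top2_pf.
  have pf_dup a b : a = k \/ b = k -> pfU [:: top k, top a, top b & L] = 0.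
    move=> ab; apply: pfl_mem; [exact: U_skew | exact: U_diag |].
    by rewrite !inE !(inj_eq (@lshift_inj _ _)); case: ab => ->; rewrite eqxx ?orbT.
  case: (ord3_cases k i) => ->; rewrite ?ord3_neq ?eqxx.
  + by rewrite pf_total_rot mul1r addrC subrr.
  + by rewrite pf_dup ?mul0r ?subr0 ?oppr0 ?add0r //; right.
  by rewrite pf_dup ?mul0r ?subr0 ?oppr0 ?add0r //; left.
apply/matrixP => i j; rewrite -[i]rev_ordK -[j]rev_ordK.
move: (rev_ord i) (rev_ord j) => {}i {}j; rewrite !mxE big_ord1 !mxE !(can_eq rev_ordK) !rev_ordK.
under eq_bigr => c _ do rewrite !mxE !(can_eq rev_ordK) rev_ordK mulrBr.
rewrite sumrB !sum_delta.
by case: (ord3_cases k i) => ->; case: (ord3_cases k j) => ->;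
  rewrite ?ord3_neq ?eqxx ?andbT ?mulr0n ?mulr1n /=; ring.
Qed.

Lemma htp_deg2 k : res3 *m htp2 k + htp1 k *m res2 = (top_pf k)%:M.
Proof.
rewrite mul_col_row mulmx_block !mul0mx !mulmx0 !add0r !addr0 add_block_mx.
rewrite !addr0 scalar_mx_block; congr block_mx.
- apply/matrixP => i j; rewrite mulmxA !mxE big_ord1 !mxE.
  under eq_bigr => l _ do rewrite !mxE.
  rewrite sum_top_low_pf.
  under eq_bigr => c _ do rewrite !mxE mulrC mulrBr ![(i == _) && _]andbC.
  rewrite sumrB !sum_delta !rev_ordK.
  by case: (ord3_cases k i) => ->; case: (ord3_cases k j) => ->;
    rewrite ?ord3_neq ?eqxx ?andbT ?mulr0n ?mulr1n /=; ring.
- apply/matrixP => i l; rewrite !mxE.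
  under eq_bigr => c _ do rewrite !mxE.
  rewrite sum_top_low_pf2.
  under eq_bigr => c _ do rewrite !mxE mulrC mulrBr ![(i == _) && _]andbC.
  rewrite sumrB !sum_delta !rev_ordK.
  case: (ord3_cases k i) => ->; rewrite ?ord3_neq ?eqxx ?mulr0n ?mulr1n.
  + rewrite pfl_mem ?inE ?eqxx ?mulr0 ?subr0 ?addr0 //.
      exact: U_skew.
    exact: U_diag.
  + by rewrite [pfU (top k :: _)](pfl_swap U_skew [::]) /=; ring.
  by ring.
- apply/matrixP => i j; rewrite mulmxA !mxE big_ord1 !mxE.
  by under eq_bigr => l _ do rewrite !mxE; rewrite sum_low_low_pf mul0r.
apply/matrixP => i j; rewrite !mxE big_ord1 !mxE [i == j]eq_sym -low_pf2_mul_low addrC.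
rewrite mulrNN mulrC; congr (_ + _); apply: eq_bigr => l _.
by rewrite !mxE [low_pf2 k l j]low_pf2_skew [A i l]A_skew mulrNN mulrC.
Qed.

(** The entries of the lower rows of [res2] expand along a second upper index into
    [low_pf2], whose products with A are known. *)
Lemma res23 : res2 *m res3 = 0.
Proof.
rewrite mul_block_col mul0mx add0r -[RHS]col_mx0; congr col_mx; apply/matrixP => i j.
  rewrite !mxE; transitivity (\sum_l A j l * low_pf l); last exact: sum_low_low_pf.
  apply: eq_bigr => l _.
  by rewrite !mxE [A j l]A_skew !mulNr mulrC.
rewrite !mxE; move: (rev_ord i) (rev_ordK i) => r def_i.
have -> : \sum_l res2_low i l * A l j =
    \sum_l B (ordS (ordS r)) l * (top_pf (ordS r) *+ (l == j) - low_pf l * B (ordS r) j).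
  have step l : top_pf (ordS r) *+ (l == j) - low_pf l * B (ordS r) j =
      \sum_c low_pf2 (ordS r) l c * A c j.
    by rewrite -low_pf2_mul_low addrAC subrr add0r.
  under [RHS]eq_bigr => l _ do rewrite step mulr_sumr.
  rewrite exchange_big; apply: eq_bigr => c _ /=.
  under eq_bigr => l _ do rewrite mulrA.
  rewrite -mulr_suml sum_top_low_pf2 (pfl_swap U_skew [::]) mulrNN mxE -def_i rev_ordK.
  by [].
under [X in _ + X]eq_bigr => l _ do rewrite mulrBr mulrnAr mulrA.
rewrite sumrB -mulr_suml sum_top_low_pf.
rewrite -def_i; under eq_bigr => c _ do rewrite mxE rev_ordK mulrC mulrBr !mulrnAr.
have sumE (I : finType) (f : I -> S) a : \sum_c f c *+ (c == a) = f a.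
  rewrite (bigD1 a) //= eqxx big1 ?addr0 // => c /negPf->.
  exact: mulr0n.
by rewrite sumrB !sumE; ring.
Qed.

(** The homotopy kills the composite up to the factor p_k: first
    d1 d2 h1 = d1 (p_k - h0 d1) = 0 because d1 h0 = p_k, and then
    p_k d1 d2 = d1 d2 (d3 h2 + h1 d2) = 0. *)
Lemma res12 k : (forall x, top_pf k * x = 0 -> x = 0) -> res1 *m res2 = 0.
Proof.
move=> nzd; have res121 : res1 *m res2 *m htp1 k = 0.
  have /(canRL (addrK _)) E := htp_deg1 k.
  rewrite -mulmxA E mulmxBr mulmxA htp_deg0 mul_mx_scalar mul_scalar_mx.
  by rewrite subrr.
have : top_pf k *: (res1 *m res2) = 0.
  rewrite -mul_mx_scalar -htp_deg2 mulmxDr -!mulmxA (mulmxA res2 res3) res23 !mulmxA.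
  by rewrite res121 mulmx0 !mul0mx addr0.
move=> /matrixP E; apply/matrixP => i j; have := E i j; rewrite [X in X = _]mxE => H.
by rewrite [RHS]mxE; apply: nzd; rewrite H mxE.
Qed.

Lemma top_pf_null_homotopic k : null_homotopic3 res1 res2 res3 (top_pf k).
Proof.
exists (htp0 k), (htp1 k), (htp2 k); split;
  [exact: htp_deg0 | exact: htp_deg1 | exact: htp_deg2 | exact: htp_deg3].
Qed.

End SkewBlock.


(** * Pfaffians with deleted rows and columns *)

Section DeletedPfaffians.
Variable m : nat.
Local Notation N := (2 * m).+1.
Local Notation top := (@lshift 3 N).
Local Notation low := (@rshift 3 N).
Local Notation L := (lows m).

Lemma enum_top_low : enum 'I_(3 + N) = [:: top 0, top (ordS 0), top (ordS (ordS 0)) & L].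
Proof.
have iota3 n : iota 0 (3 + n) = [:: 0, 1, 2 & iota (3 + 0) n]%N by [].
apply: (inj_map val_inj); rewrite val_enum_ord iota3 iotaDl -val_enum_ord -map_comp.
rewrite [RHS]/= -map_comp; congr [:: _, _, _ & _].
by rewrite /lows -[RHS]map_comp enumT.
Qed.

Lemma filter_lows (l : seq nat) : {in l, forall i, i < 4}%N ->
  [seq x : 'I_(3 + N) <- L | x.+1 \notin l] = L.
Proof.
move=> lt4; apply/all_filterP/allP => _ /mapP[i _ ->] /=.
by apply/negP => /lt4.
Qed.

Lemma filter_lows_del (l : seq nat) (j : 'I_N) : {in l, forall i, i < 4}%N ->
  [seq x : 'I_(3 + N) <- L | x.+1 \notin rcons l (j + 4)%N] = del j L.
Proof.
move=> lt4; rewrite /lows filter_map -map_del; congr map.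
have -> : del j (enum 'I_N) = rem j (enum 'I_N) by rewrite remE index_enum_ord.
rewrite rem_filter ?enum_uniq //; apply: eq_filter => i /=.
rewrite mem_rcons inE negb_or -(inj_eq val_inj) /=.
have -> : (3 + i).+1 \notin l by apply/negP => /lt4; lia.
by rewrite andbT; congr negb; lia.
Qed.

Section General.
Variables (S : comNzRingType) (M : 'M[S]_(3 + N)).
Local Notation pfM := (pfl (fun_of_matrix M)).

Lemma pfbarE l : pfbar M l =
  pfM [seq x : 'I_(3 + N) <- [:: top 0, top (ordS 0), top (ordS (ordS 0)) & L] | x.+1 \notin l].
Proof.
rewrite /pfbar PfSE -enum_top_low enumT; congr pfl; rewrite [LHS]/enum_mem.
apply: eq_filter => x /=.
by rewrite inE.
Qed.

Lemma pfbar12 : pfbar M [:: 1; 2]%N = pfM (top (ordS (ordS 0)) :: L).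
Proof. by rewrite pfbarE /= (@filter_lows [:: 1; 2]%N) //; apply/allP. Qed.

Lemma pfbar13 : pfbar M [:: 1; 3]%N = pfM (top (ordS 0) :: L).
Proof. by rewrite pfbarE /= (@filter_lows [:: 1; 3]%N) //; apply/allP. Qed.

Lemma pfbar23 : pfbar M [:: 2; 3]%N = pfM (top 0 :: L).
Proof. by rewrite pfbarE /= (@filter_lows [:: 2; 3]%N) //; apply/allP. Qed.

Lemma pfbar1 (j : 'I_N) : pfbar M [:: 1; j + 4]%N =
  pfM [:: top (ordS 0), top (ordS (ordS 0)) & del j L].
Proof.
by rewrite pfbarE /= !inE !addn4 /= -addn4 (@filter_lows_del [:: 1]%N) //; apply/allP.
Qed.

Lemma pfbar2 (j : 'I_N) : pfbar M [:: 2; j + 4]%N =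
  pfM [:: top 0, top (ordS (ordS 0)) & del j L].
Proof.
by rewrite pfbarE /= !inE !addn4 /= -addn4 (@filter_lows_del [:: 2]%N) //; apply/allP.
Qed.

Lemma pfbar3 (j : 'I_N) : pfbar M [:: 3; j + 4]%N =
  pfM [:: top 0, top (ordS 0) & del j L].
Proof.
by rewrite pfbarE /= !inE !addn4 /= -addn4 (@filter_lows_del [:: 3]%N) //; apply/allP.
Qed.

Lemma pfbar123 (j : 'I_N) : pfbar M [:: 1; 2; 3; j + 4]%N = pfM (del j L).
Proof.
by rewrite pfbarE /= (@filter_lows_del [:: 1; 2; 3]%N) //; apply/allP.
Qed.

Lemma Pf_top_low : Pf M = pfM [:: top 0, top (ordS 0), top (ordS (ordS 0)) & L].
Proof. by rewrite PfE enum_top_low. Qed.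

End General.

Lemma pfbar_rmorph (S S' : comNzRingType) (phi : {rmorphism S -> S'})
  (M : 'M[S]_(3 + N)) l : phi (pfbar M l) = pfbar (map_mx phi M) l.
Proof. by rewrite !pfbarE pfl_rmorph; apply: eq_pfl => x y; rewrite mxE. Qed.

Lemma Pf_rmorph (S S' : comNzRingType) (phi : {rmorphism S -> S'})
  n (M : 'M[S]_n) : phi (Pf M) = Pf (map_mx phi M).
Proof. by rewrite !PfE pfl_rmorph; apply: eq_pfl => x y; rewrite mxE. Qed.

End DeletedPfaffians.

(** * The generic matrices after a change of the coefficient ring *)

Section Specialization.
Variables (m : nat) (R : comNzRingType).
Local Notation N := (2 * m).+1.
Local Notation gring K := {mpoly K[#|{: gvar m}|]}.

(** [base_change] for an arbitrary commutative ring, so that the integers and the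
    fields are treated together. *)
Definition coef_change : gring int -> gring R := map_mpoly (intr : int -> R).
HB.instance Definition _ := GRing.RMorphism.on coef_change.

Definition genA : 'M[gring R]_N := map_mx coef_change (matA m).
Definition genB : 'M[gring R]_(3, N) := map_mx coef_change (matB m).

Lemma map_matU : map_mx coef_change (matU m) = skew_block genB genA.
Proof.
rewrite /matU /skew_block map_block_mx map_mx0; congr block_mx.
by apply/matrixP => i j; rewrite !mxE rmorphN.
Qed.

Lemma genA_skew i j : genA i j = - genA j i.
Proof. by rewrite !mxE -rmorphN opprB. Qed.

Lemma genA_diag i : genA i i = 0.
Proof. by rewrite !mxE subrr rmorph0. Qed.

Lemma diff3E : map_mx coef_change (diff3 m) = res3 genB genA.
Proof. by rewrite /diff3 map_col_mx. Qed.

Lemma diff1E : map_mx coef_change (diff1 m) = res1 genB genA.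
Proof.
apply/matrixP => i j; rewrite [i]ord1 {i} !mxE.
case: (split_ordP (j : 'I_(1 + 3))) => [k ->|k ->].
  by rewrite (ord1 k) mxE /= Pf_rmorph map_matU Pf_top_low.
rewrite mxE; case: k => [[|[|[|]]]] //= lt_k; rewrite pfbar_rmorph map_matU.
- by rewrite pfbar12; congr (pfl _ (lshift _ _ :: _)); apply: val_inj.
- by rewrite pfbar13; congr (pfl _ (lshift _ _ :: _)); apply: val_inj.
by rewrite pfbar23; congr (pfl _ (lshift _ _ :: _)); apply: val_inj.
Qed.

Lemma diff2E : map_mx coef_change (diff2 m) = res2 genB genA.
Proof.
have topE (k k' : 'I_3) s : k = k' :> nat ->
    pfl (fun_of_matrix (skew_block genB genA)) (lshift N k :: s) =
    pfl (fun_of_matrix (skew_block genB genA)) (lshift N k' :: s).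
  by move/val_inj->.
have top2E (k k' a a' : 'I_3) s : k = k' :> nat -> a = a' :> nat ->
    pfl (fun_of_matrix (skew_block genB genA)) [:: lshift N k, lshift N a & s] =
    pfl (fun_of_matrix (skew_block genB genA)) [:: lshift N k', lshift N a' & s].
  by move=> /val_inj-> /val_inj->.
suff: (map_mx coef_change (diff2 m) : 'M_(1 + 3, 3 + N)) = res2 genB genA by [].
have sign4 (l : 'I_N) : (-1) ^+ (l + 4) = (-1) ^+ l :> gring R.
  by rewrite -signr_odd oddD addbF signr_odd.
apply/matrixP => i j; rewrite mxE /diff2 /res2.
case: (split_ordP i) => [k ->|k ->]; case: (split_ordP j) => [c ->|l ->].
- by rewrite row_mxEl block_mxEul ord1 !mxE /=; case: c => [[|[|[|]]]] //= _; rewrite rmorph0.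
- rewrite row_mxEr block_mxEur ord1 !mxE /= rmorphM rmorphN rmorphXn rmorphN rmorph1.
  by rewrite pfbar_rmorph map_matU pfbar123 sign4 mulNr.
- rewrite row_mxEl block_mxEdl !mxE.
  case: k => [[|[|[|k]]] lt_k]; [| | | by []];
    (case: c => [[|[|[|c]]] lt_c]; [| | | by []]);
    rewrite /= ?mulr0n ?mulr1n ?subr0 ?sub0r ?oppr0 ?rmorphN;
    lazymatch goal with
    | |- _ = 0 => exact: rmorph0
    | |- - _ = _ => apply: (congr1 -%R)
    | _ => idtac
    end;
    rewrite pfbar_rmorph map_matU ?pfbar12 ?pfbar13 ?pfbar23 /top_pf; apply: topE; by [].
rewrite row_mxEr block_mxEdr !mxE.
case: k => [[|[|[|]]]] //= lt_k;
  rewrite ?(rmorphM, rmorphN, rmorphXn, rmorph1) sign4;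
  rewrite pfbar_rmorph map_matU ?pfbar1 ?pfbar2 ?pfbar3.
- by apply: (congr1 (fun x => _ * x)); apply: top2E.
(* The cyclic order of the upper indices in the second row is 3, 1. *)
- rewrite mulNr -mulrN -(pfl_swap (U_skew _ genA_skew) [::]) /=.
  by apply: (congr1 (fun x => _ * x)); apply: top2E.
by apply: (congr1 (fun x => _ * x)); apply: top2E.
Qed.

End Specialization.


(** * Wedge products with vectors *)

Section Wedge.
Variables (S : comNzRingType) (N : nat).
Implicit Types (X T : {set 'I_N}) (u : 'rV[S]_N) (a : ext S N).

Lemma enum_ord_sorted (P : {pred 'I_N}) : pairwise (fun i j : 'I_N => i < j)%N (enum P).
Proof.
have tr : transitive (fun i j : 'I_N => i < j)%N by move=> i j k; apply: ltn_trans.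
rewrite -sorted_pairwise // /enum_mem; apply: sorted_filter => //.
have: sorted ltn (map val (enum 'I_N)) by rewrite val_enum_ord iota_ltn_sorted.
by rewrite sorted_map enumT.
Qed.

Lemma enum_setD1 X i : enum (X :\ i) = rem i (enum X).
Proof.
rewrite rem_filter ?enum_uniq // /enum_mem -filter_predI; apply: eq_filter => j /=.
by rewrite !inE.
Qed.

(** The sign of a wedge product counts the elements of X after i, that of an
    expansion the elements before i. *)
Lemma inversions_set1 X i : i \in X ->
  (inversions (X :\ i) [set i] + index i (enum X)).+1 = #|X|.
Proof.
move=> Xi; set s := enum X.
have -> : inversions (X :\ i) [set i] = count (fun j : 'I_N => i < j)%N s.
  transitivity #|[set j in X | (i < j)%N]|.
    rewrite /inversions -(card_imset _ (_ : injective (fun j : 'I_N => (j, i)))); last first.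
      by move=> j k [].
    apply: eq_card => -[j k]; rewrite inE /=.
    apply/idP/imsetP => [/and3P[Xj /set1P-> lt_ij]|[j' Xj' [-> ->]]].
      by exists j => //; move: Xj; rewrite !inE => /andP[_ ->].
    move: Xj'; rewrite !inE => /andP[-> lt_ij]; rewrite lt_ij eqxx !andbT.
    by apply/eqP => eq_ij; rewrite eq_ij ltnn in lt_ij.
  rewrite cardE -size_filter; congr size; rewrite /s /enum_mem -filter_predI.
  by apply: eq_filter => j /=; rewrite !inE andbC.
have s_i : i \in s by rewrite mem_enum.
have def_s : s = take (index i s) s ++ i :: drop (index i s).+1 s.
  by rewrite -{1}(cat_take_drop (index i s) s) (drop_nth i) ?index_mem // nth_index.
have := enum_ord_sorted (mem X); rewrite -/s {1}def_s pairwise_cat /= allrel_consr.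
case/and3P=> /andP[lt_i _] _ /andP[gt_i _].
rewrite {1}def_s count_cat /= ltnn add0n.
rewrite (_ : count _ (take _ _) = 0%N); last first.
  by apply/eqP; rewrite -leqn0 leqNgt -has_count -all_predC; apply: sub_all lt_i => j /=; lia.
have /all_filterP/(congr1 size) := gt_i; rewrite size_filter => ->.
rewrite size_drop cardE -/s; have: (index i s < size s)%N by rewrite index_mem.
by move=> lt_i_s; rewrite add0n -addnS subnK.
Qed.

Lemma wedge_vector a u X :
  wedge a (ext_vector u) X =
  \sum_(i in X) (-1) ^+ inversions (X :\ i) [set i] * a (X :\ i) * u 0 i.
Proof.
rewrite ffunE.
under eq_bigr => T _ do rewrite ffunE mulr_sumr.
rewrite exchange_big [RHS]big_mkcond; apply: eq_bigr => i _ /=.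
have [Xi|X'i] := boolP (i \in X); last first.
  rewrite big1 // => T TX; case: eqP => [XT|]; last by rewrite !mulr0.
  by have /setP/(_ i) := XT; rewrite in_setD set11 (negPf X'i) andbF.
rewrite (bigD1 (X :\ i)) ?subD1set //=.
have -> : X :\: (X :\ i) = [set i].
  by apply/setP => j; rewrite !inE; case: eqP => [->|_] //=; rewrite andNb.
rewrite eqxx mulr1 big1 ?addr0 // => T /andP[TX neq_T]; case: eqP => [XT|]; last by rewrite !mulr0.
case/eqP: neq_T; apply/setP => j; have /setP/(_ j) := XT; have /subsetP/(_ j) := TX.
rewrite !inE => TXj <-; case: (j \in T) TXj => [->|_] //; by case: (j \in X).
Qed.

Lemma contract_enum_set (J : eqType) (f : 'I_N -> J) (G : J -> seq J -> S) X :
  contract G (map f (enum X)) =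
  \sum_(i in X) (-1) ^+ index i (enum X) * G (f i) (map f (enum (X :\ i))).
Proof.
case: (pickP (mem X)) => [x0 Xx0|X0]; last first.
  have -> : X = set0 by apply/setP => x; rewrite inE; have := X0 x.
  by rewrite enum_set0 big1 // => i; rewrite inE.
rewrite (contract_sum (f x0)) size_map -[RHS]big_enum /= (big_nth x0) big_mkord.
apply: eq_bigr => k _; rewrite (nth_map x0) // index_uniq ?enum_uniq //.
by rewrite -map_del enum_setD1 remE index_uniq ?enum_uniq.
Qed.

End Wedge.

Section WedgeSkewBlock.
Variables (S : comNzRingType) (m : nat).
Local Notation N := (2 * m).+1.
Variables (B : 'M[S]_(3, N)) (A : 'M[S]_N).
Local Notation pfU := (pfl (fun_of_matrix (skew_block B A))).
Local Notation top := (@lshift 3 N).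
Local Notation low := (@rshift 3 N).
Local Notation lowS X := (map low (enum (X : {set 'I_N}))).

(** Wedging with u_k expands a Pfaffian along the row k, the sign coming from
    the rows listed in pre that have to be passed. *)
Lemma wedge_row (a : ext S N) k (pre : seq 'I_3) (X : {set 'I_N}) :
  (forall i, i \in X -> a (X :\ i) = pfU (map top pre ++ lowS (X :\ i))) ->
  odd (#|X| + size pre) -> wedge a (ext_vector (row k B)) X = pfU (top k :: map top pre ++ lowS X).
Proof.
move=> aX odd_X; rewrite wedge_vector pfl_cons contract_cat contract0 ?add0r; last first.
  move=> s1 y s2 def_s; suff [b ->] : exists b, y = top b by rewrite U_top_top mul0r.
  have: y \in map top pre by rewrite def_s mem_cat mem_head orbT.
  by case/mapP=> b _ ->; exists b.
rewrite contract_enum_set mulr_sumr size_map; apply: eq_bigr => i Xi.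
rewrite mxE U_top_low aX // -!mulrA [pfU _ * _]mulrC; rewrite !mulrA; congr (_ * _ * _).
rewrite -exprD -signr_odd -[RHS]signr_odd; congr (_ ^+ _).
move: odd_X; rewrite -(inversions_set1 Xi) oddD /= !oddD.
by case: (odd _); case: (odd _); case: (odd _).
Qed.

Lemma pf_form_low j (X : {set 'I_N}) : #|X| = (2 * j)%N -> pf_form A j X = pfU (lowS X).
Proof.
move=> cardX; rewrite ffunE cardX eqxx PfSE pfl_map; apply: eq_pfl => x y.
by rewrite U_low_low.
Qed.

Lemma card_setD1 (X : {set 'I_N}) i n : i \in X -> #|X| = n.+1 -> #|X :\ i| = n.
Proof. by move=> Xi; rewrite (cardsD1 i) Xi => -[]. Qed.

Lemma wedge_form1 j k (X : {set 'I_N}) : #|X| = (2 * j).+1 ->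
  wedge (pf_form A j) (ext_vector (row k B)) X = pfU (top k :: lowS X).
Proof.
move=> cardX; apply: (@wedge_row _ k [::]); last by rewrite cardX /= addn0 /=; lia.
by move=> i Xi; apply/pf_form_low/card_setD1.
Qed.

Lemma wedge_form2 j k l (X : {set 'I_N}) : #|X| = (2 * j).+2 ->
  wedge (wedge (pf_form A j) (ext_vector (row k B))) (ext_vector (row l B)) X =
  pfU [:: top l, top k & lowS X].
Proof.
move=> cardX; apply: (@wedge_row _ l [:: k]); last by rewrite cardX /=; lia.
by move=> i Xi; apply/wedge_form1/card_setD1.
Qed.

Lemma wedge_form3 j k l h (X : {set 'I_N}) : #|X| = (2 * j).+3 ->
  wedge (wedge (wedge (pf_form A j) (ext_vector (row k B))) (ext_vector (row l B)))
    (ext_vector (row h B)) X =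
  pfU [:: top h, top l, top k & lowS X].
Proof.
move=> cardX; apply: (@wedge_row _ h [:: l; k]); last by rewrite cardX /=; lia.
by move=> i Xi; apply/wedge_form2/card_setD1.
Qed.

End WedgeSkewBlock.


(** * Generators and bidegrees *)

Section Generators.
Variables (m : nat) (R : comNzRingType).
Hypothesis m_gt0 : (0 < m)%N.
Local Notation N := (2 * m).+1.
Local Notation gring K := {mpoly K[#|{: gvar m}|]}.
Local Notation coef_change := (@coef_change m R).
Local Notation genA := (genA m R).
Local Notation genB := (genB m R).
Local Notation genU := (skew_block genB genA).
Local Notation pfU := (pfl (fun_of_matrix genU)).
Local Notation top := (@lshift 3 N).
Local Notation L := (lows m).

Lemma coef_change_pfl s : coef_change (pfl (fun_of_matrix (matU m)) s) = pfU s.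
Proof. by rewrite pfl_rmorph -map_matU; apply: eq_pfl => x y; rewrite [RHS]mxE. Qed.

(** The wedge products list the upper indices in the order 3, 2, 1; reversing it
    is an odd permutation, whence the sign. *)
Lemma In_gensE : map coef_change (In_gens m) =
  [:: - pf_total genB genA; top_pf genB genA 0; top_pf genB genA (ordS 0);
      top_pf genB genA (ordS (ordS 0))].
Proof.
have enumN : enum [set: 'I_N] = enum 'I_N by rewrite enum_setT enumT.
have i0 : inord 0 = 0 :> 'I_3 by apply: val_inj; rewrite /= inordK.
have i1 : inord 1 = ordS 0 :> 'I_3 by apply: val_inj; rewrite /= inordK.
have i2 : inord 2 = ordS (ordS 0) :> 'I_3 by apply: val_inj; rewrite /= inordK.
rewrite /In_gens /top_coef /Cform /uform i0 i1 i2 /=.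
have cardT : #|[set: 'I_N]| = N by rewrite cardsT card_ord.
have cardT3 : #|[set: 'I_N]| = (2 * m.-1).+3 by rewrite cardT; lia.
have form1 k : coef_change (wedge (pf_form (matA m) m) (ext_vector (row k (matB m))) [set: 'I_N]) =
    top_pf genB genA k.
  rewrite (wedge_form1 (matB m) (matA m) k cardT) -[skew_block _ _]/(matU m) coef_change_pfl.
  by rewrite enumN.
have form3 : coef_change (wedge (wedge (wedge (pf_form (matA m) m.-1) (ext_vector (row 0 (matB m))))
      (ext_vector (row (ordS 0) (matB m)))) (ext_vector (row (ordS (ordS 0)) (matB m)))
      [set: 'I_N]) = - pf_total genB genA.
  rewrite (wedge_form3 (matB m) (matA m) 0 (ordS 0) (ordS (ordS 0)) cardT3).
  rewrite -[skew_block _ _]/(matU m) coef_change_pfl enumN.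
  have skewU B := @U_skew _ m B _ (@genA_skew m R).
  rewrite (pfl_swap (skewU genB) [:: _]) (pfl_swap (skewU genB) [::]).
  by rewrite (pfl_swap (skewU genB) [:: _]) /= opprK.
apply: (f_equal4 (fun a b c d => [:: a; b; c; d])).
- exact: form3.
- exact: (form1 0).
- exact: (form1 (ordS 0)).
exact: (form1 (ordS (ordS 0))).
Qed.

Lemma In_gens_ideal x :
  cyclic_pi (map coef_change (In_gens m)) x = 0 <-> exists w, x%:M = res1 genB genA *m w.
Proof.
set s := map coef_change (In_gens m).
have -> : cyclic_pi s x = 0 <-> in_ideal s x.
  rewrite -(raddf0 (cyclic_pi s)); split=> [/cyclic_piP|s_x].
    by rewrite subr0 => /ideal_predP.
  by apply/cyclic_piP; rewrite subr0; apply/ideal_predP.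
have s_total : in_ideal s (pf_total genB genA).
  rewrite -[pf_total _ _]opprK -mulN1r; apply/in_idealM/in_ideal_mem.
  by rewrite /s In_gensE mem_head.
have s_top k : in_ideal s (top_pf genB genA k).
  apply: in_ideal_mem; rewrite /s In_gensE.
  case: (ord3_cases 0 k) => ->; first by rewrite in_cons mem_head orbT.
    by rewrite 2!in_cons mem_head !orbT.
  by rewrite 3!in_cons mem_head !orbT.
split; last first.
  case=> w /(congr1 (fun M : 'M_1 => M 0 0)); rewrite mxE eqxx mulr1n => ->.
  rewrite mxE; apply: in_ideal_sum => j _; rewrite mulrC; apply: in_idealM.
  by case: (split_ordP (j : 'I_(1 + 3))) => k ->;
    rewrite ?row_mxEl ?row_mxEr !mxE ?ord1 ?eqxx ?mulr1n.
apply: (@in_ideal_min _ _ (fun x => exists w, x%:M = res1 genB genA *m w)).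
- by exists 0; rewrite mulmx0 raddf0.
- by move=> y z [v Ev] [w Ew]; exists (v + w); rewrite mulmxDr -Ev -Ew raddfD.
have resM y w a : y%:M = res1 genB genA *m w -> exists w, (a * y)%:M = res1 genB genA *m w.
  by move=> Ey; exists (a *: w); rewrite -scalemxAr -Ey scale_scalar_mx.
move=> a y; rewrite /s In_gensE !inE => /or4P[] /eqP->;
  apply: resM; try exact/esym/htp_deg0.
rewrite -mulN1r -[RHS](_ : res1 genB genA *m (- col_mx 1%:M 0) = _) //.
rewrite mulmxN mul_row_col mulmx1 mulmx0 addr0.
by rewrite mulN1r raddfN.
Qed.

End Generators.


Section Bidegrees.
Variables (m : nat) (R : comNzRingType).
Hypothesis m_gt0 : (0 < m)%N.
Local Notation N := (2 * m).+1.
Local Notation gring K := {mpoly K[#|{: gvar m}|]}.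
Local Notation genA := (genA m R).
Local Notation genB := (genB m R).
Local Notation genU := (skew_block genB genA).
Local Notation pfU := (pfl (fun_of_matrix genU)).
Local Notation top := (@lshift 3 N).
Local Notation low := (@rshift 3 N).
Local Notation L := (lows m).
Implicit Types (P Q : gring R).

Lemma gbidegD (mu nu : 'X_{1..#|{: gvar m}|}) : gbideg (mu + nu)%MM =
  ((gbideg mu).1 + (gbideg nu).1, (gbideg mu).2 + (gbideg nu).2)%N.
Proof.
by rewrite /gbideg /= -!big_split; congr (_, _); apply: eq_bigr => v _; rewrite mnmDE.
Qed.

Lemma gbideg0 : gbideg (0%MM : 'X_{1..#|{: gvar m}|}) = (0, 0)%N.
Proof. by rewrite /gbideg !big1 // => v _; rewrite mnm0E. Qed.

Lemma gbidegU (v : gvar m) : gbideg U_(enum_rank v)%MM = (if v is inl _ then (1, 0) else (0, 1))%N.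
Proof.
have ranksE w : (U_(enum_rank v) (enum_rank (w : gvar m)) = (v == w))%MM.
  by rewrite mnm1E (inj_eq enum_rank_inj).
rewrite /gbideg; under eq_bigr => w _ do rewrite ranksE.
under [X in (_, X)]eq_bigr => w _ do rewrite ranksE.
case: v {ranksE} => v; congr (_, _).
- rewrite (bigD1 v) //= eqxx big1 // => w /eqP neq_w; case: eqP => // E.
  by case: neq_w; have := congr1 (fun z : gvar m => if z is inl x then x else v) E.
- by rewrite big1.
- by rewrite big1.
rewrite (bigD1 v) //= eqxx big1 // => w /eqP neq_w; case: eqP => // E.
by case: neq_w; have := congr1 (fun z : gvar m => if z is inr x then x else v) E.
Qed.

Local Opaque gbideg.

(** Counting upper and lower indices instead of variables makes a Pfaffian
    homogeneous in its list of indices: a variable c has two lower indices, a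
    variable u one upper and one lower index. *)
Definition index_degree p q P := forall mu, mu \in msupp P ->
  (gbideg mu).2 = p /\ (2 * (gbideg mu).1 + (gbideg mu).2 = q)%N.

Lemma index_degree0 p q : index_degree p q 0.
Proof. by move=> mu; rewrite msupp0. Qed.

Lemma index_degreeN p q P : index_degree p q P -> index_degree p q (- P).
Proof. by move=> dP mu; rewrite (perm_mem (msuppN P)) => /dP. Qed.

Lemma index_degreeD p q P Q : index_degree p q P -> index_degree p q Q -> index_degree p q (P + Q).
Proof. by move=> dP dQ mu /msuppD_le; rewrite mem_cat => /orP[/dP|/dQ]. Qed.

Lemma index_degree_sign p q k P : index_degree p q P -> index_degree p q ((-1) ^+ k * P).
Proof.
by move=> dP; rewrite -signr_odd; case: (odd k); rewrite ?mulN1r ?mul1r //; apply: index_degreeN.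
Qed.

Lemma index_degree_mulrb p q (b : bool) P : index_degree p q P -> index_degree p q (P *+ b).
Proof. by case: b => // _; apply: index_degree0. Qed.

Lemma index_degreeM p q p' q' P Q : index_degree p q P -> index_degree p' q' Q ->
  index_degree (p + p') (q + q') (P * Q).
Proof.
move=> dP dQ mu /msuppM_le /allpairsP[ab [/dP[<- <-] /dQ[<- <-] ->]].
rewrite gbidegD; case: (gbideg ab.1) (gbideg ab.2) => a1 b1 [a2 b2] /=.
by split=> //; lia.
Qed.

Lemma index_degreeX v : index_degree (if v is inl _ then 0 else 1)%N
  (if v is inl _ then 2 else 1)%N 'X_(enum_rank (v : gvar m)).
Proof. by move=> mu; rewrite msuppX inE => /eqP->; rewrite gbidegU; case: v. Qed.

Lemma coef_change_gX (v : gvar m) : coef_change R (gX v) = 'X_(enum_rank v).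
Proof. exact: map_mpolyX. Qed.

Lemma genBE k i : genB k i = 'X_(enum_rank (inr (k, i) : gvar m)).
Proof. by rewrite !mxE coef_change_gX. Qed.

Lemma cgen_gt (i j : 'I_N) : (j <= i)%N -> cgen i j = 0.
Proof. by rewrite /cgen leqNgt; case: insubP => //= u ->. Qed.

Lemma genA_lt (i j : 'I_N) (lt_ij : (i < j)%N) :
  genA i j = 'X_(enum_rank (inl (Sub (i, j) lt_ij) : gvar m)).
Proof.
rewrite !mxE (@cgen_gt j i) 1?ltnW // subr0 -coef_change_gX /cgen; congr (coef_change _ _).
case: insubP => [u _ def_u|]; last by rewrite lt_ij.
by congr (gX (inl _)); apply: val_inj.
Qed.

Definition is_top (x : 'I_(3 + N)) := (x < 3)%N.

Lemma is_top_top k : is_top (top k).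
Proof. exact: (ltn_ord k). Qed.

Lemma genU_index_degree x y :
  index_degree (is_top x + is_top y) (~~ is_top x + ~~ is_top y) (genU x y).
Proof.
have [i ->|i ->] := split_ordP x; have [j ->|j ->] := split_ordP y;
  rewrite U_E /is_top /= ?ltn_ord /=; try exact: index_degree0.
- by rewrite genBE; exact (@index_degreeX (inr (i, j))).
- by rewrite genBE; exact (index_degreeN (@index_degreeX (inr (j, i)))).
case: (ltngtP i j) => [lt_ij|lt_ji|/val_inj->].
- by rewrite genA_lt; exact (@index_degreeX (inl (Sub (i, j) lt_ij))).
- by rewrite genA_skew genA_lt; exact (index_degreeN (@index_degreeX (inl (Sub (j, i) lt_ji)))).
by rewrite genA_diag; apply: index_degree0.
Qed.

Lemma pfU_index_degree s : index_degree (count is_top s) (count (predC is_top) s) (pfU s).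
Proof.
have [p] := ubnP (size s); elim: p s => // p IHp [|x s] /= le_p.
  by move=> mu; rewrite pfl_nil msupp1 inE => /eqP->; rewrite gbideg0.
rewrite pfl_cons; apply: (@contract_ind _ _ (index_degree _ _)).
- exact: index_degree0.
- by move=> P Q dP dQ; apply/index_degreeD/index_degreeN.
move=> s1 y s2 def_s; have lt_s : (size (s1 ++ s2) < p)%N.
  by move: le_p; rewrite def_s !size_cat /=; lia.
have := index_degreeM (@genU_index_degree x y) (IHp (s1 ++ s2) lt_s).
by rewrite def_s !count_cat /= -!addnA !(addnCA (count _ s1)).
Qed.

Lemma count_del_lows (j : 'I_N) :
  (count is_top (del j L) = 0) * (count (predC is_top) (del j L) = 2 * m)%N.
Proof.
have topN : count is_top (del j L) = 0%N.
  apply/eqP; rewrite -leqn0 leqNgt -has_count; apply/hasPn => x.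
  by rewrite del_lowsE => /mapP[i _ ->].
by split=> //; have := count_predC is_top (del j L); rewrite topN del_lowsE size_map size_enum_ord.
Qed.

Lemma count_lows : (count is_top L = 0) * (count (predC is_top) L = N)%N.
Proof.
have topN : count is_top L = 0%N.
  by apply/eqP; rewrite -leqn0 leqNgt -has_count; apply/hasPn => x /mapP[i _ ->].
by split=> //; have := count_predC is_top L; rewrite topN size_map size_enum_ord.
Qed.

Lemma pf_total_degree : index_degree 3 N (pf_total genB genA).
Proof.
have := @pfU_index_degree [:: top 0, top (ordS 0), top (ordS (ordS 0)) & L].
by rewrite /= !count_lows.
Qed.

Lemma top_pf_degree k : index_degree 1 N (top_pf genB genA k).
Proof. by have := @pfU_index_degree (top k :: L); rewrite /= !count_lows !is_top_top. Qed.

Lemma low_pf_degree j : index_degree 0 (2 * m) (low_pf genB genA j).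
Proof.
by apply: index_degree_sign; have := @pfU_index_degree (del j L); rewrite !count_del_lows.
Qed.

Lemma res2_low_degree k j : index_degree 2 (2 * m) (res2_low genB genA k j).
Proof.
rewrite mxE; apply: index_degree_sign; set a := ordS _; set b := ordS _.
have := @pfU_index_degree [:: top a, top b & del j L].
by rewrite /= !count_del_lows !is_top_top.
Qed.

Lemma basis_bidegrees1 : basis_bidegrees (term1 m) = (m.-1, 3)%N :: nseq 3 (m, 1)%N.
Proof. by rewrite /basis_bidegrees /term1 !binn !mul1n. Qed.

Lemma basis_bidegrees2 :
  basis_bidegrees (term2 m) = nseq 3 (2 * m, 2)%N ++ nseq N ((2 * m).-1, 3)%N.
Proof.
by rewrite /basis_bidegrees /term2 !binn !binSn exp1n !mul1n muln1 /= cats0.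
Qed.

Lemma basis_bidegrees3 : basis_bidegrees (term3 m) = nseq N (2 * m, 3)%N.
Proof. by rewrite /basis_bidegrees /term3 !binn exp1n !muln1 /= cats0. Qed.

Lemma nth_basis1_low (k : 'I_3) :
  nth (0, 0)%N ((m.-1, 3)%N :: nseq 3 (m, 1)%N) (rshift 1 k) = (m, 1)%N.
Proof. by case: k => [[|[|[|]]]]. Qed.

Lemma nth_basis2_top k :
  nth (0, 0)%N (nseq 3 (2 * m, 2)%N ++ nseq N ((2 * m).-1, 3)%N) (top k) = (2 * m, 2)%N.
Proof. by case: k => [[|[|[|]]]]. Qed.

Lemma nth_basis2_low l :
  nth (0, 0)%N (nseq 3 (2 * m, 2)%N ++ nseq N ((2 * m).-1, 3)%N) (low l) = ((2 * m).-1, 3)%N.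
Proof.
have E : (low l < 3)%N = false by rewrite ltnNge leq_addr.
by rewrite nth_cat size_nseq E addKn nth_nseq ltn_ord.
Qed.

Lemma index_degreeP p q P mu a b : index_degree p q P -> mu \in msupp P ->
  b = p -> (2 * a + b = q)%N -> gbideg mu = (a, b).
Proof.
move=> dP /dP[]; case: (gbideg mu) => a' b' /= -> eq_q -> eq_q'; congr (_, _); lia.
Qed.

Lemma res1_bigraded :
  bigraded_map (@gbideg m) (term1 m) [:: (1, (0, 0))]%N (res1 genB genA).
Proof.
split=> //; rewrite ?basis_bidegrees1 //.
move=> i j mu; rewrite [i]ord1; case: (split_ordP (j : 'I_(1 + 3))) => k ->.
  rewrite row_mxEl !ord1 mxE eqxx mulr1n => mu_in.
  by rewrite (index_degreeP (a := m.-1) (b := 3) pf_total_degree mu_in) /= ?addn0 //; lia.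
rewrite row_mxEr mxE nth_basis1_low => mu_in.
rewrite (index_degreeP (a := m) (b := 1) (@top_pf_degree (rev_ord k)) mu_in) /= ?addn0 //; lia.
Qed.

Lemma res2_bigraded :
  bigraded_map (@gbideg m) (term2 m) (term1 m) (res2 genB genA).
Proof.
rewrite /bigraded_map basis_bidegrees1 basis_bidegrees2 size_cat !size_nseq; split=> //.
move=> i j mu; case: (split_ordP (i : 'I_(1 + 3))) => k ->; case: (split_ordP j) => l ->;
  rewrite ?block_mxEul ?block_mxEur ?block_mxEdl ?block_mxEdr ?nth_basis1_low
    ?nth_basis2_top ?nth_basis2_low.
- by rewrite mxE msupp0.
- rewrite !mxE !ord1 => mu_in.
  rewrite (index_degreeP (a := m) (b := 0) (index_degreeN (@low_pf_degree l)) mu_in) //=;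
    by [lia | congr (_, _); lia].
- move=> mu_in.
  have deg : index_degree 1 N (res2_cross genB genA k l).
    by rewrite mxE; apply: index_degreeD;
      [|apply: index_degreeN]; apply: index_degree_mulrb; apply: top_pf_degree.
  rewrite (index_degreeP (a := m) (b := 1) deg mu_in) /=; by [lia | congr (_, _); lia].
move=> mu_in; rewrite (index_degreeP (a := m.-1) (b := 2) (@res2_low_degree k l) mu_in) //=.
  by congr (_, _); lia.
by lia.
Qed.

Lemma res3_bigraded :
  bigraded_map (@gbideg m) (term3 m) (term2 m) (res3 genB genA).
Proof.
rewrite /bigraded_map basis_bidegrees2 basis_bidegrees3 size_cat !size_nseq; split=> //.
move=> i j mu; rewrite nth_nseq ltn_ord; case: (split_ordP i) => k ->.
  rewrite col_mxEu nth_basis2_top genBE msuppX inE => /eqP->.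
  by rewrite gbidegU.
rewrite col_mxEd nth_basis2_low => mu_in.
have := @genU_index_degree (low k) (low j); rewrite U_E => deg.
rewrite (index_degreeP (a := 1) (b := 0) deg mu_in) //=.
by congr (_, _); lia.
Qed.

(** An entry with a constant term would join two basis elements of the same
    bidegree. *)
Lemma bigraded_minimal p q F G (d : 'M[gring R]_(p, q)) :
  bigraded_map (@gbideg m) F G d ->
  (forall a b, a \in basis_bidegrees F -> b \in basis_bidegrees G -> a != b) ->
  minimal_map d.
Proof.
case=> szF szG deg neqFG v i; rewrite mxE raddf_sum big1 // => j _.
rewrite [LHS]/= rmorphM /= memN_msupp_eq0 ?mul0r //; apply/negP => /deg.
rewrite gbideg0 /= !add0n -surjective_pairing => E.
have Fj : nth (0, 0)%N (basis_bidegrees F) j \in basis_bidegrees F by rewrite mem_nth ?szF.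
have Gi : nth (0, 0)%N (basis_bidegrees G) i \in basis_bidegrees G by rewrite mem_nth ?szG.
by have := neqFG _ _ Fj Gi; rewrite E eqxx.
Qed.

Lemma res1_minimal : minimal_map (res1 genB genA).
Proof.
apply: bigraded_minimal res1_bigraded _ => a b; rewrite basis_bidegrees1.
by rewrite !inE => /or4P[] /eqP-> /eqP->; rewrite xpair_eqE andbF.
Qed.

Lemma res2_minimal : minimal_map (res2 genB genA).
Proof.
apply: bigraded_minimal res2_bigraded _ => a b; rewrite basis_bidegrees1 basis_bidegrees2.
rewrite mem_cat !mem_nseq => /orP[]/andP[_ /eqP->]; rewrite !inE => /or4P[] /eqP->;
  rewrite xpair_eqE /= ?andbF ?andbT //; lia.
Qed.

Lemma res3_minimal : minimal_map (res3 genB genA).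
Proof.
apply: bigraded_minimal res3_bigraded _ => a b; rewrite basis_bidegrees2 basis_bidegrees3.
rewrite mem_cat !mem_nseq => /andP[_ /eqP->] /orP[]/andP[_ /eqP->];
  rewrite xpair_eqE /= ?andbF ?andbT //; lia.
Qed.

End Bidegrees.


(** * Initial monomials of the Pfaffians *)

Section GenericInitial.
Variables (m : nat) (R : comNzRingType).
Local Notation N := (2 * m).+1.
Local Notation gring K := {mpoly K[#|{: gvar m}|]}.
Local Notation mnm := 'X_{1..#|{: gvar m}|}.
Local Notation genA := (genA m R).
Local Notation genB := (genB m R).
Local Notation genU := (skew_block genB genA).
Local Notation pfU := (pfl (fun_of_matrix genU)).
Local Notation top := (@lshift 3 N).
Local Notation low := (@rshift 3 N).
Local Notation L := (lows m).
Local Notation base := (2 * m + 4)%N.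

(** The lower indices are placed on a line, and the upper ones before, in the
    middle of, and after them. *)
Definition top_position (k : 'I_3) : nat := (k * m.+1)%N.
Definition low_position (i : 'I_N) : nat := i.+1.
Definition position (x : 'I_(3 + N)) : nat :=
  match split x with inl k => top_position k | inr i => low_position i end.

Lemma position_top k : position (top k) = top_position k.
Proof. by rewrite /position -[top k]/(unsplit (inl k)) unsplitK. Qed.

Lemma position_low i : position (low i) = low_position i.
Proof. by rewrite /position -[low i]/(unsplit (inr i)) unsplitK. Qed.

Definition distance (a b : nat) := ((a - b) + (b - a))%N.

Definition var_ends (v : gvar m) : nat * nat :=
  match v with
  | inl p => (low_position (val p).1, low_position (val p).2)
  | inr p => (top_position p.1, low_position p.2)
  end.

Definition var_weight v := (base ^ distance (var_ends v).1 (var_ends v).2)%N.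
Definition var_sum v := ((var_ends v).1 + (var_ends v).2)%N.

(** The weight of a variable grows so fast with the distance of its two indices
    that the heaviest matching pairs the two outermost indices. *)
Definition weight (mu : mnm) : nat := (\sum_v mu (enum_rank v) * var_weight v)%N.

Lemma weight0 : weight 0%MM = 0%N.
Proof. by rewrite /weight big1 // => v _; rewrite mnm0E. Qed.

Lemma weightD : {morph weight : mu nu / (mu + nu)%MM >-> (mu + nu)%N}.
Proof.
by move=> mu nu; rewrite /weight -big_split; apply: eq_bigr => v _; rewrite mnmDE mulnDl.
Qed.

HB.instance Definition _ := isMeasure.Build _ weight weight0 weightD.
Local Notation mf := (weight : measure _).

Lemma weightU v : weight U_(enum_rank v)%MM = var_weight v.
Proof.
rewrite /weight (bigD1 v) //= mnm1E eqxx mul1n big1 ?addn0 // => w neq_w.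
by rewrite mnm1E (inj_eq enum_rank_inj) eq_sym (negPf neq_w).
Qed.

Lemma genU_entry x y : x != y -> ~~ (is_top x && is_top y) ->
  exists (e : bool) v, [/\ genU x y = (-1) ^+ e * 'X_(enum_rank v),
    var_weight v = (base ^ distance (position x) (position y))%N
    & var_sum v = (position x + position y)%N].
Proof.
have distC a b : distance a b = distance b a by rewrite /distance addnC.
have [i ->|i ->] := split_ordP x; have [j ->|j ->] := split_ordP y;
  rewrite U_E ?position_top ?position_low.
- by rewrite !is_top_top.
- by exists false, (inr (i, j)); rewrite genBE mul1r.
- exists true, (inr (j, i)); rewrite genBE mulN1r.
  by split=> //; [rewrite /var_weight distC | rewrite /var_sum addnC].
case: (ltngtP i j) => [lt_ij|lt_ji|/val_inj eq_ij].
- by exists false, (inl (Sub (i, j) lt_ij)); rewrite genA_lt mul1r.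
- exists true, (inl (Sub (j, i) lt_ji)); rewrite genA_skew genA_lt mulN1r.
  by split=> //; [rewrite /var_weight distC | rewrite /var_sum addnC].
by rewrite eq_ij eqxx.
Qed.

Lemma genU_below D x y : (distance (position x) (position y) <= D)%N ->
  below mf (base ^ D).+1 (genU x y).
Proof.
move=> le_D; have [->|neq_xy] := eqVneq x y.
  by rewrite U_diag; [apply: below0 | exact: genA_diag].
have [/andP[]|not_top] := boolP (is_top x && is_top y).
  have [i ->|i ->] := split_ordP x; have [j ->|j ->] := split_ordP y; rewrite ?U_E //.
  by move=> *; apply: below0.
have [e [v [-> wt_v _]]] := genU_entry neq_xy not_top.
have bX : below mf (base ^ D).+1 ('X_(enum_rank v) : gring R).
  apply: (below_leq _ (@belowX _ _ mf U_(enum_rank v)%MM)).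
  by rewrite /= weightU wt_v ltnS leq_exp2l //; lia.
by case: (e); rewrite ?mulN1r ?mul1r //; apply: belowN.
Qed.

(** The bound is crude, as the number of factors of a term is only half of the
    length of the list. *)
Lemma pfU_below D s :
  (forall x y, x \in s -> y \in s -> distance (position x) (position y) <= D)%N ->
  below mf (size s * base ^ D).+1 (pfU s).
Proof.
have [p] := ubnP (size s); elim: p s => // p IHp [|x s] /= le_p dist_s.
  by move=> mu; rewrite pfl_nil msupp1 inE => /eqP->; rewrite /= weight0.
rewrite pfl_cons; apply: (@contract_ind _ _ (below mf _)).
- exact: below0.
- by move=> P Q bP bQ; apply: belowB.
move=> s1 y s2 def_s.
have sz : size s = (size (s1 ++ s2)).+1 by rewrite def_s !size_cat /= addnS.
have sub z : z \in s1 ++ s2 -> z \in x :: s.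
  by rewrite def_s !inE !mem_cat inE => /orP[]->; rewrite ?orbT.
have bM : below mf (base ^ D).+1 (genU x y).
  by apply/genU_below/dist_s; rewrite ?mem_head // inE def_s mem_cat mem_head !orbT.
have lt_s : (size (s1 ++ s2) < p)%N by move: le_p; rewrite sz; lia.
have bP := IHp _ lt_s (fun z w sz sw => dist_s z w (sub z sz) (sub w sw)).
apply: (below_leq _ (belowM bM bP)); rewrite sz; move: (size _) (base ^ D)%N => a b.
by rewrite !mulSn; lia.
Qed.

(** The initial monomial comes from the nested matching, in which c is the common
    sum of the positions of two partners; it makes the initial monomials for
    different c coprime. *)
Definition nested c s := exists (e : bool) (mu : mnm),
  [/\ initial mf mu ((-1) ^+ e * pfU s), s != [::] -> mu != 0%MM
    & forall v, mu (enum_rank v) != 0%N -> var_sum v = c].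

Lemma nested_nil c : nested c [::].
Proof.
exists false, 0%MM; split=> // [|v]; last by rewrite mnm0E.
have -> : (-1) ^+ false * pfU [::] = 'X_[0%MM] :> gring R by rewrite mpolyX0 mulr1.
exact: initialX.
Qed.

(** In the expansion along x, only the term with y contains a variable as heavy as
    the one that joins x and y.  The other terms have fewer than [base] factors,
    all joining indices that are closer to each other. *)
Lemma nested_step c x y s :
  x != y -> ~~ (is_top x && is_top y) -> (position x + position y = c)%N ->
  (position x <= position y)%N ->
  (forall z, z \in s -> position x < position z < position y)%N ->
  (size s + 2 < base)%N -> nested c s -> nested c (x :: rcons s y).
Proof.
move=> neq_xy ntop sum_xy le_xy between lt_s [e [mu [init_mu _ sum_mu]]].
have [e' [v [def_xy wt_v sum_v]]] := genU_entry neq_xy ntop.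
exists (odd (e + e' + size s)), (U_(enum_rank v) + mu)%MM; split.
- rewrite signr_odd pfl_cons -cats1 contract_cat /= subr0 cats0 mulrDr addrC def_xy.
  rewrite /initial; set c1 := contract _ _.
  set q := (X in X + _ - _).
  have -> : q = 'X_(enum_rank v) * ((-1) ^+ e * pfU s).
    rewrite /q !exprD; case: (odd (size s)) (signr_odd (gring R) (size s)) => /= <-.
      by case: (e) (e'); case=> /=; ring.
    by case: (e) (e'); case=> /=; ring.
  rewrite addrAC; apply: belowD.
    exact: (initialM (@initialX _ R mf U_(enum_rank v)%MM) init_mu).
  suff b1 : below mf (base ^ distance (position x) (position y)) c1.
    have b2 : below mf (mf (U_(enum_rank v) + mu)%MM) c1.
      by apply: below_leq b1; rewrite mfD /= weightU wt_v leq_addr.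
    by rewrite -signr_odd; case: (odd _); rewrite ?mulN1r ?mul1r //; apply: belowN.
  apply: (@contract_ind _ _ (below mf _)).
  - exact: below0.
  - by move=> P Q bP bQ; apply: belowB.
  move=> s1 z s2 def_s.
  have s_z : z \in s by rewrite def_s mem_cat mem_head orbT.
  have := between z s_z; set px := position x; set py := position y => z_between.
  have def_D : distance px py = (py - px.+1).+1 by rewrite /distance; lia.
  set D := (py - px.+1)%N in def_D.
  have bz : below mf (base ^ D).+1 (genU x z).
    by apply: genU_below; rewrite -/px /distance /D; lia.
  have bt : below mf (size ((s1 ++ s2) ++ [:: y]) * base ^ D).+1 (pfU ((s1 ++ s2) ++ [:: y])).
    have pos_t w : w \in (s1 ++ s2) ++ [:: y] -> (px < position w <= py)%N.
      rewrite mem_cat inE => /orP[w_s|/eqP->]; last by rewrite -/py; lia.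
      by have := between w; rewrite def_s mem_cat inE orbCA -mem_cat w_s orbT => /(_ isT); lia.
    by apply: pfU_below => w w' /pos_t + /pos_t; rewrite /distance /D; lia.
  apply: (below_leq _ (belowM bz bt)).
  have -> : size ((s1 ++ s2) ++ [:: y]) = size s by rewrite def_s !size_cat /=; lia.
  rewrite def_D expnS; move: lt_s (expn_gt0 base D); move: (size s) (base ^ D)%N => a b.
  by rewrite addn_gt0 orbT /=; nia.
- move=> _; rewrite -mdeg_eq0 mdegD mdeg1; lia.
move=> w; rewrite mnmDE mnm1E (inj_eq enum_rank_inj); have [<- _|_] := eqVneq v w.
  by rewrite sum_v.
exact: sum_mu.
Qed.

Lemma top_positionE : (top_position 0 = 0%N) * (top_position (ordS 0) = m.+1) *
  (top_position (ordS (ordS 0)) = (2 * m).+2).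
Proof.
rewrite /top_position (_ : nat_of_ord (ordS (ordS 0)) = 2) // (_ : nat_of_ord (ordS 0) = 1) //.
by do ![split]; lia.
Qed.

Definition low_seg a n := [seq low (inord j) | j <- iota a n].

Lemma low_segD a n1 n2 : low_seg a (n1 + n2) = low_seg a n1 ++ low_seg (a + n1) n2.
Proof. by rewrite /low_seg iotaD map_cat. Qed.

Lemma lows_seg : L = low_seg 0 N.
Proof.
rewrite /lows /low_seg -val_enum_ord -map_comp; apply: eq_map => i /=.
by rewrite inord_val.
Qed.

Lemma position_inord j : (j < N)%N -> position (low (inord j)) = j.+1.
Proof. by move=> lt_j; rewrite position_low /low_position inordK. Qed.

Lemma low_seg_position a n z : z \in low_seg a n -> (a + n <= N)%N ->
  (a < position z <= a + n)%N.
Proof.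
by case/mapP=> j; rewrite mem_iota => lt_j -> le_N; rewrite position_inord; lia.
Qed.

Lemma is_top_low i : is_top (low i) = false.
Proof. by []. Qed.

Lemma nested_low_seg t a : (a + 2 * t <= N)%N -> nested (2 * a + 2 * t).+1 (low_seg a (2 * t)).
Proof.
elim: t a => [|t IHt] a le_N; first exact: nested_nil.
have -> : low_seg a (2 * t.+1) =
    low (inord a) :: rcons (low_seg a.+1 (2 * t)) (low (inord (a + (2 * t).+1))).
  have -> : (2 * t.+1 = 1 + (2 * t + 1))%N by lia.
  have -> : (a + (2 * t).+1 = a + 1 + 2 * t)%N by lia.
  by rewrite !low_segD -[a.+1]addn1 -cats1.
apply: nested_step; rewrite ?is_top_low ?position_inord //; try lia.
- by apply/eqP => /(congr1 position); rewrite !position_inord; lia.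
- by move=> z /low_seg_position pos_z; have := pos_z ltac:(lia); lia.
- by rewrite size_map size_iota; lia.
by have := IHt a.+1; rewrite (_ : (2 * a.+1 + 2 * t = 2 * a + 2 * t.+1)%N); [apply; lia | lia].
Qed.

Lemma nested_top0 : nested (2 * m).+1 (top 0 :: L).
Proof.
have -> : L = rcons (low_seg 0 (2 * m)) (low (inord (2 * m))).
  rewrite -cats1; have -> : low_seg 0 (2 * m) ++ [:: low (inord (2 * m))] =
    low_seg 0 (2 * m + 1) by rewrite low_segD.
  by rewrite lows_seg; congr low_seg; lia.
apply: nested_step; rewrite ?is_top_low ?andbF ?position_inord ?position_top ?top_positionE //.
- by move=> z /low_seg_position pos_z; have := pos_z ltac:(lia); lia.
- by rewrite size_map size_iota; lia.
exact: (@nested_low_seg m 0).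
Qed.

Lemma nested_top2 : nested (2 * m).+3 (rcons L (top (ordS (ordS 0)))).
Proof.
have -> : L = low (inord 0) :: low_seg 1 (2 * m) by rewrite lows_seg.
rewrite rcons_cons.
apply: nested_step; rewrite ?is_top_low ?position_inord ?position_top // ?top_positionE; try lia.
- by move=> z /low_seg_position pos_z; have := pos_z ltac:(lia); lia.
- by rewrite size_map size_iota; lia.
exact: (@nested_low_seg m 1).
Qed.

(** The lower index in the middle is the partner of the upper index, and has the
    same position. *)
Lemma nested_top1 t : (t <= m)%N ->
  nested (2 * m).+2 (low_seg (m - t) t.+1 ++ top (ordS 0) :: low_seg m.+1 t).
Proof.
elim: t => [|t IHt] le_t.
  rewrite subn0; apply: (@nested_step _ (low (inord m)) (top (ordS 0)) [::]);
    rewrite ?is_top_low ?position_inord ?position_top // ?top_positionE; try lia.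
  - by rewrite /=; lia.
  exact: nested_nil.
have -> : low_seg (m - t.+1) t.+2 ++ top (ordS 0) :: low_seg m.+1 t.+1 =
    low (inord (m - t.+1)) ::
      rcons (low_seg (m - t) t.+1 ++ top (ordS 0) :: low_seg m.+1 t) (low (inord (m.+1 + t))).
  have -> : low_seg m.+1 t.+1 = low_seg m.+1 (t + 1) by congr low_seg; lia.
  have -> : low_seg (m - t.+1) t.+2 = low_seg (m - t.+1) (1 + t.+1) by [].
  have -> : (m - t = m - t.+1 + 1)%N by lia.
  by rewrite !low_segD -cats1 /= -!catA.
apply: nested_step; rewrite ?is_top_low ?position_inord ?position_top //; try lia.
- by apply/eqP => /(congr1 position); rewrite !position_inord; lia.
- move=> z; rewrite mem_cat => /orP[|/predU1P[->|]].
  + by move=> /low_seg_position pos_z; have := pos_z ltac:(lia); lia.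
  + by rewrite position_top top_positionE; lia.
  by move=> /low_seg_position pos_z; have := pos_z ltac:(lia); lia.
- by rewrite size_cat /= !size_map !size_iota; lia.
by apply: IHt; lia.
Qed.

Lemma nested_top_pf c k s1 s2 : L = s1 ++ s2 -> nested c (s1 ++ top k :: s2) ->
  exists (e : bool) (mu : mnm), [/\ initial mf mu ((-1) ^+ e * top_pf genB genA k), mu != 0%MM
    & forall v, mu (enum_rank v) != 0%N -> var_sum v = c].
Proof.
move=> def_L [e [mu [init_mu nz_mu sum_mu]]]; exists (odd (e + size s1)), mu; split=> //.
  rewrite signr_odd exprD /top_pf def_L.
  rewrite (pfl_move (@U_skew _ m genB _ (@genA_skew m R)) [::] (top k)) /=.
  by rewrite -mulrA (mulrA ((-1) ^+ size s1)) -expr2 sqrr_sign mul1r.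
by apply: nz_mu; case: (s1).
Qed.

Lemma top_pf_initial k :
  exists (e : bool) (mu : mnm), [/\ initial mf mu ((-1) ^+ e * top_pf genB genA k), mu != 0%MM
    & forall v, mu (enum_rank v) != 0%N -> var_sum v = ((2 * m).+1 + k)%N].
Proof.
case: (ord3_cases 0 k) => ->.
- by apply: (@nested_top_pf _ _ [::]) => //; rewrite addn0; apply: nested_top0.
- apply: (@nested_top_pf _ _ (low_seg 0 m.+1) (low_seg m.+1 m)).
    by rewrite lows_seg -low_segD; congr low_seg; lia.
  by have := nested_top1 (leqnn m); rewrite subnn addn1.
apply: (@nested_top_pf _ _ L [::]); first by rewrite cats0.
by rewrite cats1 addn2; apply: nested_top2.
Qed.

(** A variable determines the sum of the positions of its indices, so that the
    three initial monomials have no variable in common. *)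
Lemma top_pf_regular : exists e : 'I_3 -> bool,
  weakly_regular [seq (-1) ^+ e k * top_pf genB genA k | k <- enum 'I_3].
Proof.
have /fin_all_exists[e /fin_all_exists[mu /all_and3[init_mu nz_mu sum_mu]]] := top_pf_initial.
exists e; apply: (weakly_regular_initial (mf := mf) (mus := mu)) => // i j v neq_ij.
apply/norP => -[]; rewrite -[v]enum_valK => /sum_mu sum_i /sum_mu; rewrite sum_i.
by move=> /addnI/val_inj eq_ij; rewrite eq_ij eqxx in neq_ij.
Qed.

End GenericInitial.


(** * The resolution *)

Section Resolution.
Variables (m : nat) (R : comNzRingType).
Hypothesis m_gt0 : (0 < m)%N.
Local Notation N := (2 * m).+1.
Local Notation gring K := {mpoly K[#|{: gvar m}|]}.
Local Notation d1 := (res1 (genB m R) (genA m R)).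
Local Notation d2 := (res2 (genB m R) (genA m R)).
Local Notation d3 := (res3 (genB m R) (genA m R)).
Local Notation gens := (map (coef_change R) (In_gens m)).

Lemma null_homotopic3M (x c : gring R) :
  null_homotopic3 d1 d2 d3 x -> null_homotopic3 d1 d2 d3 (c * x).
Proof.
case=> h0 [h1 [h2 [H0 H1 H2 H3]]]; exists (c *: h0), (c *: h1), (c *: h2).
by rewrite -!scalemxAr -!scalemxAl -!scalerDr H0 H1 H2 H3 !scale_scalar_mx.
Qed.

(** The signs that make the initial coefficients equal to 1 do not affect the
    homotopies. *)
Lemma exists_regular : exists xs : seq (gring R), [/\ weakly_regular xs, size xs = 3,
  {in xs, forall x, null_homotopic3 d1 d2 d3 x} &
  forall x, top_pf (genB m R) (genA m R) 0 * x = 0 -> x = 0].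
Proof.
have [e reg] := top_pf_regular m R; set s := map _ _ in reg.
exists s; split=> //; first by rewrite size_map size_enum_ord.
  move=> _ /mapP[k _ ->]; apply/null_homotopic3M/top_pf_null_homotopic.
  - exact: genA_skew.
  - exact: genA_diag.
move=> x px0; have := reg 0%N; rewrite size_map size_enum_ord => /(_ isT x).
rewrite take0 (nth_map 0) ?size_enum_ord // (nth_ord_enum _ 0) -mulrA px0 mulr0.
by move=> /(_ (in_ideal0 _))/in_ideal_nil.
Qed.

Lemma res_comp : d1 *m d2 = 0 /\ d2 *m d3 = 0.
Proof.
have [xs [_ _ _ nzd]] := exists_regular; split.
  by apply: (res12 (@genA_skew m R) (@genA_diag m R) nzd).
by apply: (res23 _ (@genA_skew m R) (@genA_diag m R)).
Qed.

Lemma res_exact :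
  [/\ forall v : 'cV_N, d3 *m v = 0 -> v = 0,
      forall v : 'cV_(3 + N), d2 *m v = 0 <-> exists w, v = d3 *m w
    & forall v : 'cV_(1 + 3), d1 *m v = 0 <-> exists w, v = d2 *m w].
Proof.
have [xs [reg sz htp _]] := exists_regular; have [d12 d23] := res_comp.
exact (exact3 d12 d23 reg sz htp).
Qed.

Lemma res_resolution :
  minimal_graded_free_resolution (@gbideg m) gens (term3 m) (term2 m) (term1 m)
    (map_mx (coef_change R) (diff3 m)) (map_mx (coef_change R) (diff2 m))
    (map_mx (coef_change R) (diff1 m)).
Proof.
rewrite diff1E diff2E diff3E; have [inj3 ex2 ex1] := res_exact; split.
- by split; [apply: res3_bigraded | apply: res2_bigraded | apply: res1_bigraded].
- by split=> // x; apply: In_gens_ideal.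
by split; [apply: res3_minimal | apply: res2_minimal | apply: res1_minimal].
Qed.

Lemma res3_not_split Y : Y *m d3 <> 1%:M.
Proof.
move=> Y3; have := @res3_minimal m R m_gt0.
move=> min3; have /(congr1 (fun M : 'M[gring R]_N => (M 0 0)@_0%MM)) := Y3.
have E : forall i, (d3 i 0)@_0%MM = 0.
  by move=> i; have := min3 (delta_mx 0 0) i; rewrite -colE mxE.
rewrite [in RHS]mxE eqxx mulr1n mcoeff1 eqxx mxE raddf_sum big1 => [/eqP|i _].
  by rewrite eq_sym oner_eq0.
by rewrite [LHS]/= rmorphM /= E mulr0.
Qed.

Lemma gens_proper x : in_ideal gens x -> x@_0%MM = 0.
Proof.
move=> Ix; have /In_gens_ideal[//|w /(congr1 (fun M : 'M[gring R]_1 => (M 0 0)@_0%MM))] :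
    cyclic_pi gens x = 0.
  by rewrite -(raddf0 (cyclic_pi gens)); apply/cyclic_piP; rewrite subr0; apply/ideal_predP.
by rewrite mxE eqxx mulr1n => ->; apply: res1_minimal.
Qed.

Lemma gens_perfect : perfect_of_grade gens 3.
Proof.
have [inj3 ex2 ex1] := res_exact; have [d12 d23] := res_comp.
have ex2' v := (ex2 v).1; have ex1' v := (ex1 v).1.
have in_gens x : in_ideal gens x <-> exists w, x%:M = d1 *m w.
  rewrite -In_gens_ideal // -(raddf0 (cyclic_pi gens)); split=> [Ix|/cyclic_piP].
    by apply/cyclic_piP; rewrite subr0; apply/ideal_predP.
  by rewrite subr0 => /ideal_predP.
split; [split|split].
- have [xs [reg sz htp _]] := exists_regular; exists xs; split=> //.
    split=> // xs1; have : in_ideal gens 1.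
      apply: in_ideal_sub xs1 => y /htp[h0 [_ [_ [H0 _ _ _]]]].
      by apply/in_gens; exists h0.
    by move=> /gens_proper/eqP; rewrite mcoeff1 eqxx oner_eq0.
  by move=> x /htp[h0 [_ [_ [H0 _ _ _]]]]; apply/in_gens; exists h0.
- move=> xs [reg _] Ixs; rewrite leqNgt; apply/negP => gt3.
  have d1_xs : {in xs, forall x, exists w, x%:M = d1 *m w} by move=> x /Ixs/in_gens.
  have [Y Y3] := regular_size_le3 d12 d23 inj3 ex2' ex1' reg d1_xs gt3.
  by case: (res3_not_split Y3).
- apply: (proj_dim_le3 d12 d23 inj3 ex2' ex1') => x; exact: In_gens_ideal.
move=> d' pd; apply: (proj_dim_ge3 d12 d23 inj3 ex2' ex1' _ res3_not_split pd) => x.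
exact: In_gens_ideal.
Qed.

End Resolution.

Lemma coef_change_int m (p : {mpoly int[#|{: gvar m}|]}) : coef_change int p = p.
Proof. by apply/mpolyP => mu; rewrite mcoeff_map_mpoly /= intz. Qed.

Theorem proposition3p4 (m : nat) (hm : (1 <= m)%N) :
  minimal_graded_free_resolution (@gbideg m) (In_gens m)
    (term3 m) (term2 m) (term1 m) (diff3 m) (diff2 m) (diff1 m)
  /\
  forall k : fieldType,
    minimal_graded_free_resolution (@gbideg m) (map (@base_change m k) (In_gens m))
      (term3 m) (term2 m) (term1 m)
      (map_mx (@base_change m k) (diff3 m))
      (map_mx (@base_change m k) (diff2 m))
      (map_mx (@base_change m k) (diff1 m))
    /\
    perfect_of_grade (map (@base_change m k) (In_gens m)) 3.
Proof.
split; last by move=> k; split; [apply: res_resolution | apply: gens_perfect].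
have := @res_resolution m int hm.
have -> : map (coef_change int) (In_gens m) = In_gens m.
  by apply: map_id_in => p _; apply: coef_change_int.
have map_coef_change p q (M : 'M_(p, q)) : map_mx (@coef_change m int) M = M.
  by apply/matrixP => i j; rewrite mxE coef_change_int.
by rewrite !map_coef_change.
Qed.
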